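(* Let $\Gamma$ be a finite two-person non-zero-sum player-2 controlled undiscounted stochastic game that is completely mixed. If the payoff matrix $R^1(s)$ of player 1 is nonsingular for every $s\in S$, then $\Gamma$ has a unique Nash equilibrium.
   Context: A finite two-person stochastic game consists of a finite state space $S=\{s_1,\dots,s_K\}$, finite nonempty sets $A_1(s),A_2(s)$ of pure actions of players 1 and 2 in each state $s\in S$, real rewards $r^k(i,j,s)$ to player $k\in\{1,2\}$ when actions $i\in A_1(s)$, $j\in A_2(s)$ are chosen in state $s$, and transition probabilities $q(s'|s,i,j)$. The payoff matrix of player $k$ in state $s$ is $R^k(s)=(r^k(i,j,s))_{i,j}$. Both players maximize their payoffs. The game is player-2 controlled if $q(s'|s,i,j)=q(s'|s,j)$ for all $s,s',i,j$. A stationary strategy of player $k$ assigns to each $s\in S$ a probability distribution on $A_k(s)$; $\mathbb{P}_k$ is the set of stationary strategies of player $k$. It is completely mixed if in every state every pure action has strictly positive probability. For $f\in\mathbb{P}_1$, $g\in\mathbb{P}_2$, let $r_k^{(n)}(f,g,s)$ be the expected reward to player $k$ on day $n$ ($n=0,1,2,\dots$) when play starts in state $s$ and $(f,g)$ is used. The undiscounted payoff is $\Phi^k(f,g)(s)=\liminf_{N\to\infty}\frac1{N+1}\sum_{n=0}^N r_k^{(n)}(f,g,s)$. A pair $(f^0,g^0)$ of stationary strategies is a Nash equilibrium of the undiscounted game if $\Phi^1(f^0,g^0)\ge\Phi^1(f,g^0)$ for all $f\in\mathbb{P}_1$ and $\Phi^2(f^0,g^0)\ge\Phi^2(f^0,g)$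 for all $g\in\mathbb{P}_2$, coordinatewise over states. The game is completely mixed if for every Nash equilibrium both strategies are completely mixed. *)

(* Defs.v *)
From HB Require Import structures.
From mathcomp Require Import all_boot all_order all_algebra.
From mathcomp Require Import all_classical all_reals all_analysis.

Set Implicit Arguments.
Unset Strict Implicit.
Unset Printing Implicit Defensive.

Import Order.TTheory GRing.Theory Num.Theory.
Import numFieldNormedType.Exports.
Local Open Scope ring_scope.

Inductive player := P1 | P2.

(* States are 'I_K; the pure actions of player k in state s are
   'I_(actions k s); [transition G s i j s'] is q(s' | s, i, j). *)
Record stochastic_game (R : realType) (K : nat) := StochasticGame {
  actions : player -> 'I_K -> nat;
  reward : player -> forall s : 'I_K, 'M[R]_(actions P1 s, actions P2 s);
  transition : forall s : 'I_K,
    'I_(actions P1 s) -> 'I_(actions P2 s) -> 'I_K -> R;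
  actions_gt0 : forall k s, (0 < actions k s)%N;
  transition_ge0 : forall s i j s', 0 <= @transition s i j s';
  transition_sum1 : forall s i j, \sum_(s' < K) @transition s i j s' = 1
}.

Arguments reward {R K} _ _ _.
Arguments transition {R K} _ _ _ _ _.

Section Games.
Variables (R : realType) (K : nat) (G : stochastic_game R K).

(* Families of row vectors; the probability constraints are carried by
   [stationary]. *)
Definition strategy (k : player) : Type :=
  forall s : 'I_K, 'rV[R]_(actions G k s).

Definition stationary (k : player) (f : strategy k) : Prop :=
  forall s, (forall i, 0 <= f s 0 i) /\ \sum_i f s 0 i = 1.

Definition completely_mixed (k : player) (f : strategy k) : Prop :=
  forall s i, 0 < f s 0 i.

Definition stage_reward (k : player) (f : strategy P1) (g : strategy P2)
    (s : 'I_K) : R :=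
  \sum_i \sum_j f s 0 i * g s 0 j * reward G k s i j.

Definition transition_mx (f : strategy P1) (g : strategy P2) : 'M[R]_K :=
  \matrix_(s, s') \sum_i \sum_j f s 0 i * g s 0 j * transition G s i j s'.

(* Under (f, g) the state process is a Markov chain, so the law of the state
   on day n from s is row s of the n-th power of its transition matrix. *)
Definition day_reward (k : player) (n : nat) (f : strategy P1)
    (g : strategy P2) (s : 'I_K) : R :=
  \sum_t (transition_mx f g ^+ n) s t * stage_reward k f g t.

(* For stationary f and g the averages are bounded, so the real-valued
   [limn_inf] is the actual limit inferior. *)
Definition undiscounted_payoff (k : player) (f : strategy P1)
    (g : strategy P2) (s : 'I_K) : R :=
  limn_inf (fun N : nat =>
    (N.+1%:R)^-1 * \sum_(0 <= n < N.+1) day_reward k n f g s).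

Definition nash_equilibrium (f0 : strategy P1) (g0 : strategy P2) : Prop :=
  [/\ stationary f0, stationary g0,
      forall f, stationary f -> forall s,
        undiscounted_payoff P1 f g0 s <= undiscounted_payoff P1 f0 g0 s
    & forall g, stationary g -> forall s,
        undiscounted_payoff P2 f0 g s <= undiscounted_payoff P2 f0 g0 s].

Definition completely_mixed_game : Prop :=
  forall f g, nash_equilibrium f g ->
    completely_mixed f /\ completely_mixed g.

Definition player2_controlled : Prop :=
  forall (s : 'I_K) (i i' : 'I_(actions G P1 s)) (j : 'I_(actions G P2 s))
    (s' : 'I_K), transition G s i j s' = transition G s i' j s'.

End Games.

(* Being square is part of nonsingularity. *)
Definition nonsingular (R : realType) (m n : nat) (A : 'M[R]_(m, n)) : Prop :=
  exists e : m = n, castmx (e, erefl n) A \in unitmx.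

(* Main.v *)
Require Import Defs.
From mathcomp Require Import all_boot all_order all_algebra.
From mathcomp Require Import all_classical all_reals all_analysis.
From mathcomp Require Import ring lra fintype finset.

Set Implicit Arguments.
Unset Strict Implicit.
Unset Printing Implicit Defensive.

Import Order.TTheory GRing.Theory Num.Theory.
Import numFieldNormedType.Exports.
Local Open Scope ring_scope.

(** Player 2 alone moves the state, so a stationary strategy [g] fixes a Markov
    chain [law g]. If [Q] is the limit of the averages of its powers and [r] the
    vector of expected stage rewards, the undiscounted payoffs are [Q r]
    ([undiscounted_payoffE]), and there is a bias [h] with
    [Q r + h = r + law g h] ([ergodic_projection]). As [Q] depends on [g] only,
    player 1 optimizes state by state: [f] is optimal against [g] exactly when
    [f t] is a best reply to [g t] in the matrix game [R^1(t)] at each state [t]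
    charged by [Q] ([optimal1P]).

    Uniqueness. Let [(f, g)] be an equilibrium, hence completely mixed, with gain
    [v = Q r] and bias [h]. Policy improvement shows that [v] is harmonic for
    every action of player 2 ([gain_harmonic]). If some action improved the bias
    equation at [s] without improving the gain, switching to it would make [s]
    transient, where nothing that player 1 does matters, and the switched pair
    would be an equilibrium that is not completely mixed. So all the actions of
    player 2 solve the same average-reward equations ([nash_equalizing]), and
    player 2 is indifferent between all strategies. The same trick shows that
    player 2 has a single action at a state that is transient under [g]
    ([null_state_single]). At any other state [t], optimality of the positive
    vector [f t] makes [R^1(t) g(t)] a constant vector, and nonsingularity then
    determines [g t]. Finally the equations of [nash_equalizing] are affine in
    [f]: the line through two solutions would leave the positive strategies at a
    point that is again an equilibrium.

    Existence. For a positive discount rate, player 1 still optimizes state by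
    state, and an equilibrium comes from a bimatrix game between pure stationary
    plans ([discounted_equilibrium]). Comparing a discounted value with the
    average payoff of a fixed strategy costs an error proportional to the rate
    ([supersolution_ge], [subsolution_le]), so a limit of discounted equilibria
    as the rate vanishes is an equilibrium of the undiscounted game
    ([equilibrium_exists]). Equilibria of bimatrix games come from the parity
    argument of Lemke and Howson: a simple polytope whose facets carry labels has
    an even number of completely labelled vertices ([full_even],
    [edge_two_ends]), the origin is one, and any other one is, after
    normalization, an approximate equilibrium ([linear_complementarity],
    [bimatrix_equilibrium]). *)

(** * Stochastic matrices and their ergodic projections *)

Section Stochastic.
Variables (R : realType) (n : nat).
Implicit Types (P Q X : 'M[R]_n) (u v w : 'cV[R]_n).

Definition stochastic P :=
  (forall i j, 0 <= P i j) /\ (forall i, \sum_j P i j = 1).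

(** [Q] is the limit of the averages of the powers of [P], and [X] sends a
    reward vector to a bias: the last equation applied to [r] reads
    [Q r + X r = r + P X r]. *)
Definition ergodic P Q X :=
  [/\ stochastic Q, P *m Q = Q, Q *m P = Q & 1%:M - Q = (1%:M - P) *m X].

Lemma stochastic1 : stochastic 1%:M.
Proof.
split=> [i j|i]; first by rewrite mxE ler0n.
rewrite (bigD1 i) //= big1 ?addr0 => [|j ji]; first by rewrite mxE eqxx.
by rewrite mxE eq_sym (negPf ji).
Qed.

Lemma stochasticM P Q : stochastic P -> stochastic Q -> stochastic (P *m Q).
Proof.
move=> [P0 P1] [Q0 Q1]; split=> [i j|i].
  by rewrite mxE sumr_ge0 // => k _; rewrite mulr_ge0.
under eq_bigr do rewrite mxE.
rewrite exchange_big /=; under eq_bigr do rewrite -mulr_sumr Q1 mulr1.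
exact: P1.
Qed.

Lemma stochasticX P k : stochastic P -> stochastic (P ^+ k).
Proof.
move=> Pst; elim: k => [|k IHk]; first exact: stochastic1.
by rewrite exprS; apply: stochasticM.
Qed.

Lemma stochastic_le P u v : stochastic P ->
  (forall i, u i 0 <= v i 0) -> forall i, (P *m u) i 0 <= (P *m v) i 0.
Proof.
move=> [P0 _] uv i; rewrite !mxE ler_sum // => j _.
exact: ler_wpM2l.
Qed.

Lemma stochastic_const P (c : R) : stochastic P ->
  P *m const_mx c = const_mx c :> 'cV_n.
Proof.
move=> [_ P1]; apply/colP => i; rewrite !mxE.
under eq_bigr do rewrite mxE.
by rewrite -mulr_suml P1 mul1r.
Qed.

Lemma stochastic_norm P u c : stochastic P ->
  (forall i, `|u i 0| <= c) -> forall i, `|(P *m u) i 0| <= c.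
Proof.
move=> [P0 P1] uc i; rewrite mxE; apply: le_trans (ler_norm_sum _ _ _) _.
rewrite -[leRHS]mul1r -(P1 i) mulr_suml ler_sum // => j _.
by rewrite normrM ger0_norm // ler_wpM2l.
Qed.

Lemma col_bounded u : exists2 c, 0 <= c & forall i, `|u i 0| <= c.
Proof.
exists (\sum_i `|u i 0|) => [|i]; first exact: sumr_ge0.
by rewrite (bigD1 i) //= lerDl sumr_ge0.
Qed.

Lemma telescope_powers P u N :
  \sum_(0 <= k < N) (P ^+ k) *m (u - P *m u) = u - (P ^+ N) *m u.
Proof.
elim: N => [|N IHN]; first by rewrite big_nil expr0 mul1mx subrr.
rewrite big_nat_recr //= IHN exprSr mulmxBr mulmxA.
by rewrite addrA subrK.
Qed.

(** A vector fixed by [P] and of the form [u - P u] would make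
    [P ^ k u = u - k (u - P u)] unbounded. *)
Lemma stochastic_ker_im P m (Y : 'M[R]_(n, m)) : stochastic P ->
  (1%:M - P) *m ((1%:M - P) *m Y) = 0 -> (1%:M - P) *m Y = 0.
Proof.
move=> Pst eq0; apply/matrixP => i j; rewrite [RHS]mxE.
pose u := col j Y; pose x := u - P *m u.
have xE : x = col j ((1%:M - P) *m Y).
  by rewrite colE -mulmxA -colE mulmxBl mul1mx.
have Px : P *m x = x.
  apply/eqP; rewrite eq_sym -subr_eq0 xE -[X in X - _]mul1mx -mulmxBl.
  by rewrite colE mulmxA eq0 mul0mx.
have Pkx k : P ^+ k *m x = x.
  by elim: k => [|k IHk]; rewrite ?expr0 ?mul1mx // exprSr -mulmxA Px.
have [c c0 uc] := col_bounded u.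
have bnd k : `|x i 0| *+ k <= c *+ 2.
  have := telescope_powers P u k; rewrite -/x.
  under eq_bigr do rewrite Pkx.
  rewrite big_const_nat iter_addr addr0 subn0 => /(congr1 (fun z : 'cV_n => z i 0)).
  rewrite mulmxnE [RHS]mxE [X in _ + X]mxE => E.
  rewrite -normrMn E mulr2n; apply: le_trans (ler_normB _ _) _.
  apply: lerD (uc i) _.
  by apply: stochastic_norm (stochasticX k Pst) uc i.
have -> : ((1%:M - P) *m Y) i j = x i 0 by rewrite xE [RHS]mxE.
apply/eqP; rewrite -normr_le0; apply/negPn/negP; rewrite -ltNge => x0.
have := Num.Theory.archi_boundP (divr_ge0 (mulrn_wge0 2 c0) (ltW x0)).
by rewrite ltr_pdivrMr // mulr_natl ltNge bnd.
Qed.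

Local Open Scope classical_set_scope.

(** [Q r] is invariant and [r - Q r] is of the form [h - P h], whose partial
    sums telescope. *)
Lemma cesaro_cvg P Q X u i : stochastic P -> P *m Q = Q ->
  1%:M - Q = (1%:M - P) *m X ->
  (N.+1%:R^-1 * \sum_(0 <= k < N.+1) (P ^+ k *m u) i 0) @[N --> \oo]
    --> (Q *m u) i 0.
Proof.
move=> Pst PQ eqX; pose h := X *m u.
have uE : u = Q *m u + (h - P *m h).
  rewrite -[h in h - _]mul1mx -mulmxBl mulmxA -eqX mulmxBl mul1mx.
  by rewrite addrC subrK.
have PkQ k : P ^+ k *m Q = Q.
  by elim: k => [|k IHk]; rewrite ?expr0 ?mul1mx // exprSr -mulmxA PQ.
have [c c0 hc] := col_bounded h.
have sumE N : N.+1%:R^-1 * \sum_(0 <= k < N.+1) (P ^+ k *m u) i 0 =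
    (Q *m u) i 0 + N.+1%:R^-1 * (h - P ^+ N.+1 *m h) i 0.
  rewrite -telescope_powers summxE.
  rewrite [X in _ * X](_ : _ = \sum_(0 <= k < N.+1) ((Q *m u) i 0 +
     (P ^+ k *m (h - P *m h)) i 0)); last first.
    apply: eq_bigr => k _; rewrite {1}uE mulmxDr mulmxA PkQ.
    by rewrite mxE.
  rewrite big_split /= sumr_const_nat subn0 mulrDr.
  by rewrite -(mulr_natl ((Q *m u) i 0)) mulKf // pnatr_eq0.
under eq_fun do rewrite sumE.
suff err0 : N.+1%:R^-1 * (h - P ^+ N.+1 *m h) i 0 @[N --> \oo] --> (0 : R).
  by have := cvgD (cvg_cst ((Q *m u) i 0)) err0; rewrite addr0; apply.
apply/norm_cvg0P.
have lim0 : N.+1%:R^-1 * (c *+ 2) @[N --> \oo] --> (0 : R).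
  rewrite -(mul0r (c *+ 2)); apply: cvgMl.
  exact: cvg_harmonic.
apply: (squeeze_cvgr _ (cvg_cst 0) lim0); near=> N.
rewrite normr_ge0 /= normrM ger0_norm ?invr_ge0 ?ler0n //.
rewrite ler_wpM2l ?invr_ge0 ?ler0n // mulr2n [X in `|X|]mxE [X in _ + X]mxE.
apply: le_trans (ler_normB _ _) _; apply: lerD => //.
exact: stochastic_norm (stochasticX _ Pst) hc i.
Unshelve. all: by end_near.
Qed.

(** [ker (1 - P)] and [im (1 - P)] are complementary, so [(1 - P)] factors as
    [(1 - P) ^ 2 X], and [Q = 1 - (1 - P) X] is the projection on the kernel
    along the image. *)
Theorem ergodic_projection P : stochastic P -> exists Q X, ergodic P Q X.
Proof.
move=> Pst; pose A : 'M[R]_n := 1%:M - P.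
have kerA m (Y : 'M[R]_(n, m)) : A *m (A *m Y) = 0 -> A *m Y = 0.
  exact: stochastic_ker_im.
have [X AE] : exists X, A = A *m A *m X.
  have /submxP [D DE] : (A^T <= A^T *m A^T)%MS.
    rewrite -(geq_leqif (mxrank_leqif_sup (submxMl _ _))).
    have <- := mxrank_mul_ker A^T A^T.
    rewrite -[leqRHS]addn0 leq_add2l leqn0 mxrank_eq0 -submx0.
    apply/rV_subP => x; rewrite sub_capmx submx0 => /andP[/submxP[y ->] /sub_kermxP].
    move=> /(congr1 trmx); rewrite !trmx_mul trmxK trmx0 => /kerA y0.
    by rewrite -[y *m _]trmxK trmx_mul trmxK y0 trmx0.
  by exists D^T; rewrite -[LHS]trmxK DE !trmx_mul !trmxK.
pose Q := 1%:M - A *m X.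
have AQ : A *m Q = 0 by rewrite /Q mulmxBr mulmx1 mulmxA -AE subrr.
have QA : Q *m A = 0.
  have E : Q *m A = A *m (1%:M - X *m A).
    by rewrite /Q mulmxBl mul1mx [RHS]mulmxBr mulmx1 mulmxA.
  by rewrite E; apply: kerA; rewrite -E mulmxA AQ mul0mx.
have PQ : P *m Q = Q.
  by apply/eqP; rewrite eq_sym -subr_eq0 -[X in X - _]mul1mx -mulmxBl AQ.
have QP : Q *m P = Q.
  by apply/eqP; rewrite eq_sym -subr_eq0 -[X in X - _]mulmx1 -mulmxBr QA.
have eqX : 1%:M - Q = A *m X by rewrite opprB addrC subrK.
exists Q, X; split => //; split=> [i j|i].
  have := @cesaro_cvg P Q X (col j 1%:M) i Pst PQ eqX.
  rewrite colE mul1mx -colE mxE => cvgQ.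
  apply: (cvgr_to_ge cvgQ); near=> N; rewrite mulr_ge0 ?invr_ge0 ?ler0n //.
  apply: sumr_ge0 => k _; rewrite -colE mxE.
  by have [] := stochasticX k Pst.
have := @cesaro_cvg P Q X (const_mx 1) i Pst PQ eqX => cvgQ.
have cvg1 : N.+1%:R^-1 * \sum_(0 <= k < N.+1) (P ^+ k *m const_mx 1 : 'cV_n) i 0
    @[N --> \oo] --> (1 : R).
  under eq_fun => N.
    under eq_bigr => k _ do rewrite (stochastic_const 1 (stochasticX k Pst)) mxE.
    rewrite sumr_const_nat subn0 mulVf ?pnatr_eq0 //.
    over.
  exact: cvg_cst.
have := cvg_unique _ cvgQ cvg1; rewrite mxE => <- //.
by apply: eq_bigr => j _; rewrite [const_mx 1 j 0]mxE mulr1.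
Unshelve. all: by end_near.
Qed.

End Stochastic.

(** * Parity of completely labelled vertices *)

Section RatioTest.
Variables (R : realFieldType) (E : finType).

(** As [t] grows, [e1] is the first of the constraints [c e + t * a e >= 0] to
    become tight. *)
Lemma ratio_test (a c : E -> R) : (exists e, a e < 0) ->
  exists2 e1, a e1 < 0 & forall e, a e < 0 -> c e1 / - a e1 <= c e / - a e.
Proof.
move=> [e0 a0].
case: (@arg_minP _ _ _ e0 (fun e => a e < 0) (fun e => c e / - a e)) => //.
by move=> e1 a1 le1; exists e1.
Qed.

End RatioTest.

(** Sets of [N + 1] elements such that every set of [N] elements lies in an even
    number of them are the facets of a closed pseudomanifold modulo 2. *)
Section Parity.
Variables (E : finType) (N : nat) (label : E -> 'I_N.+1).
Variable F : {set {set E}}.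
Hypothesis F_card : forall s, s \in F -> #|s| = N.+1.
Hypothesis F_ridge : forall r : {set E}, #|r| = N ->
  ~~ odd #|[set s in F | r \subset s]|.

Definition full (s : {set E}) := label @: s == [set: 'I_N.+1].

Definition door (r : {set E}) := (#|r| == N) && (label @: r == ~: [set ord0]).

(** A completely labelled facet has one door, obtained by removing its vertex
    labelled [ord0]. In any other facet with a door, a single label is repeated,
    and the two doors are obtained by removing either vertex that carries it. *)
Lemma odd_doors s : s \in F -> odd #|[set r | door r & r \subset s]| = full s.
Proof.
move=> sF; pose D := [set e in s | label @: (s :\ e) == ~: [set ord0]].
have -> : #|[set r | door r & r \subset s]| = #|D|.
  have injr : {in D &, injective (fun e => s :\ e)}.
    move=> e e'; rewrite !inE => /andP[es _] /andP[e's _] eqD.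
    apply/eqP; apply: contraT => ne.
    by have := setD11 e s; rewrite eqD in_setD1 ne es.
  rewrite -(card_in_imset injr); congr #|pred_of_set _|; apply/setP => r.
  rewrite inE; apply/andP/imsetP => [[/andP[/eqP rN lr] rs]|[e]].
    have [e eE] : exists e, s :\: r = [set e].
      by apply/cards1P; rewrite cardsD (setIidPr rs) F_card // rN subSnn.
    have rE : r = s :\ e.
      by rewrite -eE setDDr setDv set0U (setIidPr rs).
    exists e => //; rewrite inE -rE lr andbT.
    by have := set11 e; rewrite -eE inE => /andP[].
  rewrite inE => /andP[es le] ->; split; last exact: subD1set.
  rewrite /door le andbT -eqSS -(F_card sF) (cardsD1 e s) es.
  by rewrite add1n.
have [fs|nfs] := boolP (full s).
  have inj : {in s &, injective label}.
    by apply/imset_injP; rewrite (eqP fs) cardsT card_ord F_card.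
  have /imsetP[e0 e0s l0] : ord0 \in label @: s by rewrite (eqP fs) inE.
  suff -> : D = [set e0] by rewrite cards1.
  apply/setP => e; rewrite !inE; apply/andP/eqP => [[es /eqP le]|->].
    apply/eqP; apply: contraT => ne.
    have : label e0 \in label @: (s :\ e) by rewrite imset_f // !inE eq_sym ne.
    by rewrite le -l0 !inE eqxx.
  split=> //; apply/eqP/setP => k; rewrite !inE.
  apply/imsetP/idP => [[x]|k0].
    rewrite !inE => /andP[xe xs] ->; apply: contra_neq xe.
    by rewrite l0 => /inj; apply.
  have /imsetP[x xs kx] : k \in label @: s by rewrite (eqP fs) inE.
  exists x => //; rewrite !inE xs andbT.
  by apply: contra_neq k0 => xe; rewrite kx xe.
have [->|[e eD]] := set_0Vmem D; first by rewrite cards0.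
have := eD; rewrite inE => /andP[es /eqP le].
have leP x : x \in s -> x != e -> label x != ord0.
  move=> xs xe; have : label x \in label @: (s :\ e) by rewrite imset_f // !inE xe.
  by rewrite le !inE.
have inj : {in s :\ e &, injective label}.
  apply/imset_injP; rewrite le cardsCs setCK cards1 card_ord subn1 /=.
  by have := cardsD1 e s; rewrite es F_card // => -[->].
have le0 : label e != ord0.
  apply: contra nfs => /eqP l0; rewrite /full -(setD1K es) imsetU1 le l0.
  by rewrite setUCr.
have /imsetP[e' e'D ee'] : label e \in label @: (s :\ e) by rewrite le !inE.
have := e'D; rewrite !inE => /andP[e'e e's].
suff -> : D = [set e; e'] by rewrite cards2 eq_sym e'e.
apply/setP => x; rewrite !inE; apply/andP/orP => [[xs /eqP lx]|[/eqP->|/eqP->]].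
- have [->|xe] := eqVneq x e; [by left | right].
  have /imsetP[y] : label x \in label @: (s :\ x) by rewrite lx !inE leP.
  rewrite !inE => /andP[yx ys] xy.
  have ye : y = e.
    apply: contra_neq_eq yx => ye; apply: inj => //; rewrite !inE ?ye ?xe //.
  by apply/eqP; apply: inj => //; rewrite ?inE ?xe // xy ye.
- by rewrite le.
split=> //; rewrite -le.
have exch y z : label y = label z -> z != y -> z \in s ->
    label @: (s :\ z) \subset label @: (s :\ y).
  move=> yz zy zs; apply/fintype.subsetP => _ /imsetP[w wD ->].
  have [->|wy] := eqVneq w y; first by rewrite yz imset_f // !inE zy.
  by apply: imset_f; move: wD; rewrite !inE wy => /andP[].
by rewrite eqEsubset !exch // eq_sym.
Qed.

(** Sperner's argument: count the pairs of a door and a facet containing it. *)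
Lemma full_even : ~~ odd #|[set s in F | full s]|.
Proof.
have : ~~ odd (\sum_(r | door r) #|[set s in F | r \subset s]|).
  elim/big_rec: _ => // r m dr /negbTE om; rewrite oddD om addbF.
  by apply: F_ridge; case/andP: dr => /eqP.
have -> : (\sum_(r | door r) #|[set s in F | r \subset s]| =
    \sum_(s in F) #|[set r | door r & r \subset s]|)%N.
  under eq_bigr do rewrite -sum1_card.
  under [RHS]eq_bigr do rewrite -sum1_card.
  rewrite (exchange_big_dep (mem F)) /= => [|r s _]; last by rewrite inE => /andP[].
  apply: eq_bigr => s sF; apply: eq_bigl => r; rewrite !inE.
  by rewrite sF.
suff -> : odd (\sum_(s in F) #|[set r | door r & r \subset s]|) =
    odd #|[set s in F | full s]| by [].
rewrite -sum1dep_card big_mkcondr /=.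
elim/big_rec2: _ => // s m1 m2 sF; rewrite !oddD odd_doors // => ->.
by case: (full s).
Qed.

End Parity.

(** The polytope [c + a z >= 0]. A vertex is recorded by the set of its tight
    constraints, so that these sets are the facets of the dual complex. *)
Section Polytope.
Variables (R : realFieldType) (N : nat) (E : finType).
Variables (a : E -> 'rV[R]_N.+1) (c : E -> R).
Implicit Types (z d : 'cV[R]_N.+1) (s r : {set E}).

Definition slope e d : R := (a e *m d) 0 0.
Definition slack e z : R := c e + slope e z.
Definition feasible z := forall e, 0 <= slack e z.
Definition tight z := [set e | slack e z == 0].

Lemma slopeD e d t d' : slope e (d + t *: d') = slope e d + t * slope e d'.
Proof. by rewrite /slope mulmxDr -scalemxAr [LHS]mxE [X in _ + X]mxE. Qed.

Lemma slopeZ e t d : slope e (t *: d) = t * slope e d.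
Proof. by rewrite /slope -scalemxAr [LHS]mxE. Qed.

Lemma slackD e z t d : slack e (z + t *: d) = slack e z + t * slope e d.
Proof. by rewrite /slack slopeD addrA. Qed.

Lemma common_kernel r : (#|r| < N.+1)%N ->
  exists2 d, d != 0 & forall e, e \in r -> slope e d = 0.
Proof.
move=> rN; pose M := \matrix_(k < #|r|) a (enum_val k).
have : kermx M^T != 0.
  rewrite kermx_eq0 -row_leq_rank mxrank_tr -ltnNge.
  exact: leq_ltn_trans (rank_leq_row _) rN.
case/rowV0Pn => v /sub_kermxP vM v0; exists v^T.
  by rewrite -(inj_eq (@trmx_inj _ _ _)) trmxK trmx0.
move=> e er; have : M *m v^T = 0 by apply: trmx_inj; rewrite trmx_mul trmxK trmx0.
move=> /(congr1 (row (enum_rank_in er e))).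
rewrite row_mul rowK enum_rankK_in // row0 => /matrixP/(_ 0 0).
by rewrite [RHS]mxE.
Qed.

Lemma linear_dependence r : (N.+1 < #|r|)%N ->
  exists u : E -> R, (exists2 e, e \in r & u e != 0) /\ \sum_(e in r) u e *: a e = 0.
Proof.
move=> rN; pose M := \matrix_(k < #|r|) a (enum_val k).
have : kermx M != 0.
  rewrite kermx_eq0 -row_leq_rank -ltnNge.
  exact: leq_ltn_trans (rank_leq_col _) rN.
case/rowV0Pn => v /sub_kermxP vM v0.
have [k vk] : exists k, v 0 k != 0.
  apply/existsP; apply: contraNT v0; rewrite negb_exists => /forallP v0.
  by apply/eqP/rowP => k; rewrite mxE; apply/eqP; rewrite -[_ == _]negbK.
have er := enum_valP k.
exists (fun e => v 0 (enum_rank_in er e)); split.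
  by exists (enum_val k); rewrite // enum_valK_in.
rewrite (big_enum_val (fun e => v 0 (enum_rank_in er e) *: a e)) /=.
rewrite -[RHS]vM mulmx_sum_row; apply: eq_bigr => j _.
by rewrite enum_valK_in rowK.
Qed.

Definition vertex s z :=
  [/\ feasible z, s = tight z &
      forall d, (forall e, e \in s -> slope e d = 0) -> d = 0].

Definition vertices : {set {set E}} := [set s | `[< exists z, vertex s z >]].

Hypothesis bounded : forall d, (forall e, 0 <= slope e d) -> d = 0.
Hypothesis nondegenerate : forall z, feasible z -> (#|tight z| <= N.+1)%N.

Lemma vertices_card s : s \in vertices -> #|s| = N.+1.
Proof.
rewrite inE => /asboolP[z [fz sE ker]]; apply/eqP; rewrite eqn_leq.
rewrite {1}sE nondegenerate //= leqNgt; apply/negP => /common_kernel[d d0 dr].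
by rewrite (ker d dr) eqxx in d0.
Qed.

(** The two vertices are the ends of the edge cut out by [r]: start from the
    first one in the direction [d] that leaves the constraint [e0], and stop at
    the first constraint [e1] met, which exists by boundedness and is unique by
    nondegeneracy. *)
Lemma edge_two_ends r : #|r| = N -> ~~ odd #|[set s in vertices | r \subset s]|.
Proof.
move=> rN; have [->|[s0]] := set_0Vmem [set s in vertices | r \subset s].
  by rewrite cards0.
rewrite inE => /andP[s0V rs0].
have s0N := vertices_card s0V.
have := s0V; rewrite inE => /asboolP[z0 [fz0 s0E ker0]].
have [e0 e0E] : exists e, s0 :\: r = [set e].
  by apply/cards1P; rewrite cardsD (setIidPr rs0) s0N rN subSnn.
have e0s : e0 \in s0 by have := set11 e0; rewrite -e0E inE => /andP[].
have e0r : e0 \notin r by have := set11 e0; rewrite -e0E inE => /andP[].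
have s0r e : (e \in s0) = (e == e0) || (e \in r).
  have := in_set1 e e0; rewrite -e0E inE => <-.
  have [er|] := boolP (e \in r) => /=; last by rewrite orbF.
  by rewrite (fintype.subsetP rs0).
have s0P e : (e \in s0) = (slack e z0 == 0) by rewrite {1}s0E inE.
have [d' d'0 d'r] : exists2 d, d != 0 & forall e, e \in r -> slope e d = 0.
  by apply: common_kernel; rewrite rN.
have sd' : slope e0 d' != 0.
  apply: contra_neq d'0 => e0d'; apply: ker0 => e.
  by rewrite s0r => /orP[/eqP->|/d'r].
pose d := (slope e0 d')^-1 *: d'.
have dr e : e \in r -> slope e d = 0.
  by move=> er; rewrite /d slopeZ (d'r e er) mulr0.
have de0 : slope e0 d = 1.
  by rewrite /d slopeZ mulVf.
have line z : (forall e, e \in r -> slope e z = 0) -> z = slope e0 z *: d.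
  move=> zr; apply/eqP; rewrite -subr_eq0 -scaleNr; apply/eqP/ker0 => e.
  rewrite s0r slopeD => /orP[/eqP->|er]; first by rewrite de0; ring.
  by rewrite (zr e er) (dr e er) mulr0 addr0.
have d0 : d != 0.
  by rewrite scaler_eq0 invr_eq0 negb_or sd' d'0.
have [e1 e1d T_min] : exists2 e1, slope e1 d < 0 & forall e, slope e d < 0 ->
    slack e1 z0 / - slope e1 d <= slack e z0 / - slope e d.
  apply: ratio_test; apply: contrapT => nex.
  move/eqP: d0; apply; apply: bounded => e; rewrite leNgt; apply/negP => ed.
  by apply: nex; exists e.
set T := slack e1 z0 / - slope e1 d in T_min.
have pos e : slope e d < 0 -> 0 < slack e z0.
  move=> ed; rewrite lt_def fz0 andbT -s0P s0r negb_or.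
  apply/andP; split; apply: contraTN ed; last by move=> /dr ->; rewrite ltxx.
  by move=> /eqP ->; rewrite de0 ltr10.
have T_gt0 : 0 < T by rewrite divr_gt0 ?pos // oppr_gt0.
pose z1 := z0 + T *: d.
have slack1 e : slope e d < 0 -> 0 <= slack e z1.
  move=> ed; rewrite slackD -[slope e d]opprK mulrN subr_ge0.
  by rewrite -ler_pdivlMr ?oppr_gt0 // T_min.
have e1z1 : slack e1 z1 = 0.
  by rewrite slackD /T invrN mulrN mulNr divfK ?subrr // lt_eqF.
have fz1 : feasible z1.
  move=> e; have [/slack1 //|ed] := ltP (slope e d) 0.
  by rewrite slackD addr_ge0 // mulr_ge0 // ltW.
have rz1 e : e \in r -> slack e z1 = 0.
  by move=> er; rewrite slackD dr // mulr0 addr0; apply/eqP; rewrite -s0P s0r er orbT.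
have e1r : e1 \notin r by apply: contraTN e1d => /dr ->; rewrite ltxx.
have t1E : tight z1 = e1 |: r.
  apply/esym/eqP; rewrite eqEcard; apply/andP; split.
    by apply/fintype.subsetP => e; rewrite !inE => /orP[/eqP->|/rz1->]; rewrite ?e1z1.
  by rewrite cardsU1 e1r rN nondegenerate.
have s1V : e1 |: r \in vertices.
  rewrite inE; apply/asboolP; exists z1; split; rewrite ?t1E // => z zker.
  have zE : z = slope e0 z *: d by apply: line => e er; apply: zker; rewrite !inE er orbT.
  have := zker e1; rewrite !inE eqxx => /(_ isT).
  rewrite zE slopeZ => /eqP.
  by rewrite mulf_eq0 (lt_eqF e1d) orbF => /eqP ->; rewrite scale0r.
suff -> : [set s in vertices | r \subset s] = [set s0; e1 |: r].
  rewrite cards2; suff -> : s0 != e1 |: r by [].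
  apply/eqP => /setP/(_ e1); rewrite !inE eqxx s0P => /eqP e10.
  by have := pos e1 e1d; rewrite e10 ltxx.
apply/setP => s; rewrite [LHS]in_set in_set2; apply/andP/orP; last first.
  by case=> [/eqP->|/eqP->] //; split=> //; exact: subsetUr.
case=> sV rs; have := sV; rewrite inE => /asboolP[z [fz sE ker]].
have zE : z = z0 + slope e0 (z - z0) *: d.
  rewrite -line; first by rewrite addrC subrK.
  move=> e er; have : slack e z = 0.
    by have := fintype.subsetP rs e er; rewrite sE inE => /eqP.
  have : slack e z0 = 0 by apply/eqP; rewrite -s0P s0r er orbT.
  rewrite /slack -[z - z0]/(z + - z0) -scaleN1r slopeD; lra.
move: (slope e0 (z - z0)) zE => t zE.
have t_ge0 : 0 <= t.
  have := fz e0; rewrite zE slackD de0 mulr1.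
  have /eqP -> : slack e0 z0 == 0 by rewrite -s0P.
  by rewrite add0r.
have [t0|t_neq0] := eqVneq t 0.
  by left; rewrite sE s0E zE t0 scale0r addr0.
right; suff -> : s = e1 |: r by [].
have t_gt0 : 0 < t by rewrite lt_def t_neq0.
have tT : t <= T.
  have := fz e1; rewrite zE slackD -[slope e1 d]opprK mulrN subr_ge0.
  by rewrite -ler_pdivlMr ?oppr_gt0.
rewrite -t1E sE; suff tTE : t = T by rewrite zE tTE.
have [e2 e2E] : exists e, s :\: r = [set e].
  by apply/cards1P; rewrite cardsD (setIidPr rs) vertices_card // rN subSnn.
have e2s : e2 \in s by have := set11 e2; rewrite -e2E inE => /andP[].
have e2r : e2 \notin r by have := set11 e2; rewrite -e2E inE => /andP[].
have e2z : slack e2 z0 + t * slope e2 d = 0.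
  by move: e2s; rewrite sE inE zE slackD => /eqP.
have e2e0 : e2 != e0.
  apply/eqP => e20; have e0z : slack e0 z0 = 0 by apply/eqP; rewrite -s0P.
  by move: e2z; rewrite e20 de0 e0z; lra.
have e2z0 : 0 < slack e2 z0.
  by rewrite lt_def fz0 andbT -s0P s0r negb_or e2e0.
have e2d : slope e2 d < 0.
  rewrite ltNge; apply/negP => e2d.
  have := mulr_ge0 t_ge0 e2d; lra.
apply/eqP; rewrite eq_le tT /=; apply: le_trans (T_min e2 e2d) _.
rewrite ler_pdivrMr ?oppr_gt0 //; lra.
Qed.

End Polytope.

(** * Complementary solutions of linear inequalities *)

Section Complementarity.
Variable R : realFieldType.

Lemma avoid_roots (p : {poly R}) (delta : R) : p != 0 -> 0 < delta ->
  exists t, [/\ 0 < t, t < delta & ~~ root p t].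
Proof.
move=> p0 d0; apply: contrapT => nex.
pose rs := [seq delta / k.+2%:R | k <- iota 0 (size p)].
have allr : all (root p) rs.
  apply/allP => _ /mapP[k _ ->]; apply: contrapT => /negP nr; apply: nex.
  exists (delta / k.+2%:R); split=> //; first by rewrite divr_gt0 ?ltr0n.
  by rewrite ltr_pdivrMr ?ltr0n // ltr_pMr // ltr1n.
have uniqr : uniq rs.
  rewrite map_inj_uniq ?iota_uniq // => k l /(mulfI (lt0r_neq0 d0)) /invr_inj.
  by move=> /eqP; rewrite eqr_nat => /eqP [].
by have := max_poly_roots p0 allr uniqr; rewrite size_map size_iota ltnn.
Qed.

Section Perturbation.
Variables (n : nat) (M : 'M[R]_n.+1).

Definition lcp_row (e : 'I_n.+1 * bool) : 'rV[R]_n.+1 :=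
  if e.2 then - row e.1 M else delta_mx 0 e.1.

(** Right-hand sides [1 + t ^ (i + 1)]: a linear relation between more than
    [n + 1] constraints involves some [t ^ (i + 1)], so that these constraints
    are tight together for finitely many [t] only. *)
Definition lcp_poly (e : 'I_n.+1 * bool) : {poly R} :=
  if e.2 then 1 + 'X^(e.1.+1) else 0.

Lemma slope_lcp_row e z : slope lcp_row e z =
  if e.2 then - (M *m z) e.1 0 else z e.1 0.
Proof.
rewrite /slope /lcp_row; case: e.2; last by rewrite -rowE mxE.
by rewrite mulNmx -row_mul [LHS]mxE [in LHS]mxE.
Qed.

Lemma lcp_relation (S : {set 'I_n.+1 * bool}) : exists p : {poly R}, p != 0 /\
  ((n.+1 < #|S|)%N -> forall t z,
    (forall e, e \in S -> slack lcp_row (fun e => (lcp_poly e).[t]) e z = 0) ->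
    root p t).
Proof.
have [nS|] := ltnP n.+1 #|S|; last by exists 1; rewrite ?oner_eq0.
have [u [[e0 e0S ue0] rel]] := linear_dependence lcp_row nS.
exists (\sum_(e in S) u e *: lcp_poly e); split=> [|_ t z tight0].
  have [i iS ui] : exists2 i, (i, true) \in S & u (i, true) != 0.
    apply: contrapT => nex.
    have u0 i : (i, true) \in S -> u (i, true) = 0.
      by move=> iS; apply/eqP; apply: contrapT => /negP ui; apply: nex; exists i.
    case: e0 e0S ue0 => i [] iS; first by rewrite u0 // eqxx.
    move=> /eqP; apply; move/matrixP/(_ 0 i): rel.
    rewrite (bigD1 (i, false)) //= [LHS]mxE summxE big1 => [|[j b]].
      by rewrite addr0 !mxE /= !eqxx mulr1.
    rewrite xpair_eqE => /andP[jS]; case: b jS => jS; rewrite ?andbT ?andbF => ji.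
      by rewrite u0 // scale0r mxE.
    by rewrite !mxE /= eq_sym (negPf ji) mulr0.
  apply/eqP => /(congr1 (fun p : {poly R} => p`_i.+1)); rewrite coef0 coef_sum.
  rewrite (bigD1 (i, true)) //= big1 => [|[j b]].
    rewrite coefZ /lcp_poly /= coefD coef1 coefXn eqxx add0r mulr1 addr0.
    by move/eqP; rewrite (negPf ui).
  rewrite xpair_eqE coefZ /lcp_poly => /andP[_]; case: b => /= ji;
    last by rewrite coef0 mulr0.
  rewrite coefD coef1 coefXn add0r eqSS (_ : (nat_of_ord i == j) = false) ?mulr0 //.
  by apply: contraNF ji => /eqP ij; rewrite andbT; apply/eqP/val_inj.
apply/eqP; rewrite -[RHS]oppr0 horner_sum.
transitivity (- \sum_(e in S) u e * slope lcp_row e z).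
  rewrite -sumrN; apply: eq_bigr => e eS; rewrite hornerZ -mulrN; congr (_ * _).
  by apply/eqP; rewrite -addr_eq0; apply/eqP/tight0.
congr (- _).
transitivity (((\sum_(e in S) u e *: lcp_row e) *m z) 0 0).
  rewrite mulmx_suml summxE; apply: eq_bigr => e _.
  by rewrite -scalemxAl [RHS]mxE.
by rewrite rel mul0mx mxE.
Qed.

End Perturbation.

(** The complementary vertices are those whose tight constraints carry all the
    labels; their number is even, and the origin is one of them. *)
Theorem linear_complementarity n (M : 'M[R]_n.+1) (eps : R) :
  (forall d : 'cV_n.+1, (forall i, 0 <= d i 0) ->
     (forall i, (M *m d) i 0 <= 0) -> d = 0) ->
  0 < eps ->
  exists z : 'cV_n.+1, [/\ z != 0, forall i, 0 <= z i 0,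
    forall i, (M *m z) i 0 <= 1 + eps &
    forall i, 0 < z i 0 -> 1 <= (M *m z) i 0].
Proof.
move=> Mbnd eps0.
(* A parameter [t] in [0, eps] that avoids all the coincidences. *)
have [p pP] := choice (lcp_relation M).
have [||t [t0 t_lt]] := @avoid_roots (\prod_S p S) (Num.min 1 eps) _ _.
- by rewrite prodf_seq_neq0; apply/allP => S _; have [] := pP S.
- by rewrite lt_min ltr01.
rewrite rootE horner_prod prodf_seq_neq0 => /allP nroot.
move: t_lt; rewrite lt_min => /andP[t1 teps].
pose E : finType := ('I_n.+1 * bool)%type.
pose c (e : E) : R := (lcp_poly e).[t].
have cE e : c e = if e.2 then 1 + t ^+ e.1.+1 else 0.
  by rewrite /c /lcp_poly; case: e.2; rewrite !hornerE.
have t_pow k : 0 < t ^+ k.+1 <= eps.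
  rewrite exprn_gt0 //= (le_trans _ (ltW teps)) // exprS ler_piMr ?(ltW t0) //.
  by rewrite exprn_ile1 // ltW.
have bounded d : (forall e, 0 <= slope (lcp_row M) e d) -> d = 0.
  move=> d0; apply: Mbnd => i.
    by have := d0 (i, false); rewrite slope_lcp_row.
  by have := d0 (i, true); rewrite slope_lcp_row /= oppr_ge0.
have nondegenerate z : feasible (lcp_row M) c z ->
    (#|tight (lcp_row M) c z| <= n.+1)%N.
  move=> _; rewrite leqNgt; apply/negP => card_gt.
  have [_ /(_ card_gt t z) pS] := pP (tight (lcp_row M) c z).
  have /implyP/(_ isT)/negP := nroot (tight (lcp_row M) c z) (mem_index_enum _).
  by apply; apply: pS => e; rewrite inE => /eqP.
pose V := vertices (lcp_row M) c.
have := full_even (fun e : E => e.1) (vertices_card nondegenerate)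
  (edge_two_ends bounded nondegenerate).
rewrite -/V; set FV := [set s in V | _].
pose s0 := [set e : E | ~~ e.2].
have s0_tight : s0 = tight (lcp_row M) c 0.
  apply/setP => e; rewrite !inE /slack /slope mulmx0 mxE addr0 cE.
  case: e.2 => /=; last by rewrite eqxx.
  by have /andP[? _] := t_pow e.1; rewrite gt_eqF // addr_gt0.
have s0FV : s0 \in FV.
  rewrite inE; apply/andP; split; last first.
    by apply/eqP/setP => i; rewrite inE; apply/imsetP; exists (i, false); rewrite ?inE.
  rewrite inE; apply/asboolP; exists 0; split=> // [e|d d0].
    rewrite /slack /slope mulmx0 mxE addr0 cE; case: e.2 => //.
    by have /andP[? _] := t_pow e.1; rewrite addr_ge0 // ltW.
  apply/colP => i; rewrite [RHS]mxE.
  by have := d0 (i, false); rewrite inE slope_lcp_row; apply.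
have [FV1|[s1]] := set_0Vmem (FV :\ s0).
  by rewrite (cardsD1 s0) s0FV FV1 cards0.
rewrite 3!inE => /and3P[s10 s1V s1f] _.
move: s1V; rewrite inE => /asboolP[z [fz s1E _]].
have complement i : z i 0 = 0 \/ (M *m z) i 0 = 1 + t ^+ i.+1.
  have : i \in [set e.1 | e in s1] by rewrite (eqP s1f) inE.
  move=> /imsetP[e]; rewrite s1E inE /slack slope_lcp_row cE.
  case: e => j [] /= + -> => [|]; last by rewrite add0r => /eqP; left.
  by rewrite subr_eq0 => /eqP; right.
exists z; split=> [||i|i z0].
- by apply: contra_neq s10 => z0; rewrite s1E s0_tight z0.
- by move=> i; have := fz (i, false); rewrite /slack slope_lcp_row cE add0r.
- have := fz (i, true); rewrite /slack slope_lcp_row cE subr_ge0 /= => /le_trans; apply.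
  by rewrite lerD2l; case/andP: (t_pow i).
- case: (complement i) => [zi|->]; first by rewrite zi ltxx in z0.
  by rewrite lerDl ltW //; case/andP: (t_pow i).
Qed.

End Complementarity.

(** * Equilibria of bimatrix games *)

Section Ultralimits.
Local Open Scope classical_set_scope.
Variable R : realType.

(** Limits along a single ultrafilter make all the bounded sequences converge
    together, in place of successive extractions. *)
Lemma free_ultrafilter : exists U : set_system nat, UltraFilter U /\ \oo `<=` U.
Proof. exact: ultraFilterLemma. Qed.

Lemma ultra_cvg (U : set_system nat) (u : nat -> R) (c : R) : UltraFilter U ->
  (forall k, `|u k| <= c) -> exists l : R, u k @[k --> U] --> l.
Proof.
move=> UU uc; have PU : ProperFilter (fmap u U) by exact: fmap_proper_filter.
have [|l [_ cl]] := @segment_compact R (- c) c (fmap u U) PU.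
  by apply: (@filterE _ U) => k; rewrite /= in_itv /= -ler_norml.
exists l => B Bl.
have [//|UB] := in_ultra_setVsetC (u @^-1` B) UU.
by have [x [nBx /nBx]] := cl (~` B) B UB Bl.
Qed.

Lemma ultra_cvg_family (T : Type) (U : set_system nat) (u : nat -> T -> R) (c : R) :
  UltraFilter U -> (forall k t, `|u k t| <= c) ->
  exists l : T -> R, forall t, u k t @[k --> U] --> l t.
Proof.
move=> UU uc.
have [l ul] := choice (fun t => ultra_cvg UU (fun k => uc k t)).
by exists l.
Qed.

Lemma cvg_sumr (F : set_system nat) {FF : Filter F} (I : finType)
    (u : nat -> I -> R) (l : I -> R) :
  (forall i, u k i @[k --> F] --> l i) ->
  (\sum_i u k i) @[k --> F] --> \sum_i l i.
Proof. by move=> ul; apply: (cvg_big add_continuous) => i _; exact: ul. Qed.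

End Ultralimits.

Section Distributions.
Variable R : realType.

Definition distribution (I : finType) (x : I -> R) :=
  (forall i, 0 <= x i) /\ \sum_i x i = 1.

Lemma distribution_le1 (I : finType) (x : I -> R) i : distribution x -> x i <= 1.
Proof. by move=> [x0 <-]; rewrite (bigD1 i) //= lerDl sumr_ge0. Qed.

Lemma distribution_supp (I : finType) (x : I -> R) : distribution x -> exists i, 0 < x i.
Proof.
move=> [x0 x1]; apply: contrapT => nex; have /eqP := x1.
rewrite big1 1?eq_sym ?oner_eq0 // => i _; apply/eqP; rewrite eq_le x0 andbT leNgt.
by apply/negP => xi; apply: nex; exists i.
Qed.

Section Lcp.
Variables (K : finType) (k0 : K) (M : K -> K -> R).

Lemma linear_complementarity_fin (eps : R) :
  (forall d : K -> R, (forall k, 0 <= d k) -> (forall k, \sum_l M k l * d l <= 0) ->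
     forall k, d k = 0) ->
  0 < eps ->
  exists z : K -> R, [/\ exists k, 0 < z k, forall k, 0 <= z k,
    forall k, \sum_l M k l * z l <= 1 + eps &
    forall k, 0 < z k -> 1 <= \sum_l M k l * z l].
Proof.
move=> Mbnd eps0.
have [n Kn] : exists n, #|K| = n.+1.
  by exists #|K|.-1; rewrite prednK //; apply/card_gt0P; exists k0.
pose f (i : 'I_n.+1) : K := enum_val (cast_ord (esym Kn) i).
pose g (k : K) : 'I_n.+1 := cast_ord Kn (enum_rank k).
have fK : cancel f g by move=> i; rewrite /g /f enum_valK cast_ordKV.
have gK : cancel g f by move=> k; rewrite /g /f cast_ordK enum_rankK.
pose N := \matrix_(i, j) M (f i) (f j).
have NE (z : 'cV[R]_n.+1) i : (N *m z) i 0 = \sum_l M (f i) l * z (g l) 0.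
  rewrite mxE (reindex f) /=; last by exists g => ? _; rewrite ?fK ?gK.
  by apply: eq_bigr => j _; rewrite mxE fK.
have [d d0 dN|//|z [z0 z_ge0 zle zge]] := @linear_complementarity R n N eps.
  apply/colP => i; rewrite [RHS]mxE -[i]fK.
  apply: (Mbnd (fun k => d (g k) 0)) => // k.
  by have := dN (g k); rewrite NE gK.
exists (fun k => z (g k) 0); split=> // [|k|k zk].
- apply: contrapT => nex; move/eqP: z0; apply; apply/colP => i; rewrite [RHS]mxE.
  apply/eqP; rewrite eq_le z_ge0 andbT leNgt; apply/negP => zi.
  by apply: nex; exists (f i); rewrite fK.
- by have := zle (g k); rewrite NE gK.
- by have := zge (g k) zk; rewrite NE gK.
Qed.

End Lcp.

Lemma sumr_gt0 (I : finType) (x : I -> R) i :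
  (forall j, 0 <= x j) -> 0 < x i -> 0 < \sum_j x j.
Proof. by move=> x0 xi; rewrite (bigD1 i) //= ltr_pwDl ?sumr_ge0. Qed.

(** The error [eps] is relative, so that it does not change when [y] is
    multiplied by a positive constant. *)
Definition best_reply (S T : finType) (eps : R) (x : S -> R) (y : T -> R)
    (A : S -> T -> R) :=
  forall i i', 0 < x i ->
    \sum_j A i' j * y j <= (1 + eps) * \sum_j A i j * y j.

Lemma distribution_normalize (I : finType) (x : I -> R) i :
  (forall j, 0 <= x j) -> 0 < x i -> distribution (fun j => x j / \sum_j x j).
Proof.
move=> x0 xi; have s0 := sumr_gt0 x0 xi; split=> [j|].
  by rewrite divr_ge0 // ltW.
by rewrite -mulr_suml divff // gt_eqF.
Qed.
End Distributions.

Section Bimatrix.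
Variables (R : realType) (I J : finType).

(** Solutions of the complementarity problem of the two payoff matrices are
    unnormalized equilibria. *)
Lemma approximate_bimatrix_equilibrium (i0 : I) (j0 : J) (A : I -> J -> R)
    (B : J -> I -> R) (eps : R) :
  (forall i j, 0 < A i j) -> (forall j i, 0 < B j i) -> 0 < eps ->
  exists (x : I -> R) (y : J -> R), [/\ distribution x, distribution y,
    best_reply eps x y A & best_reply eps y x B].
Proof.
move=> A0 B0 eps0.
pose M (k l : I + J) : R := match k, l with
  | inl i, inr j => A i j | inr j, inl i => B j i | _, _ => 0 end.
have MI z i : \sum_l M (inl i) l * z l = \sum_j A i j * z (inr j).
  by rewrite big_sumType /= big1 ?add0r // => k _; rewrite mul0r.
have MJ z j : \sum_l M (inr j) l * z l = \sum_i B j i * z (inl i).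
  by rewrite big_sumType /= addrC big1 ?add0r // => k _; rewrite mul0r.
have zero (T : finType) (C u : T -> R) : (forall t, 0 < C t) -> (forall t, 0 <= u t) ->
    \sum_t C t * u t <= 0 -> forall t, u t = 0.
  move=> C0 u0 le0 t; apply/eqP; rewrite eq_le u0 andbT leNgt; apply/negP => ut.
  move: le0; rewrite leNgt => /negP; apply.
  apply: (@sumr_gt0 _ _ _ t) => [s|]; last exact: mulr_gt0.
  by rewrite mulr_ge0 // ltW.
have [d d0 dM|//|z [[k zk] z0 zle zge]] := @linear_complementarity_fin R _ (inl i0) M eps.
  case=> [i|j].
    by apply: (zero _ (B j0) (fun i => d (inl i))) => // ; rewrite -MJ.
  by apply: (zero _ (A i0) (fun j => d (inr j))) => // ; rewrite -MI.
have supp (T : finType) (C u : T -> R) : 1 <= \sum_t C t * u t -> exists t, u t != 0.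
  move=> ge1; apply: contrapT => nex; move: ge1; rewrite big1 ?ler10 // => t _.
  by have [->|ut] := eqVneq (u t) 0; rewrite ?mulr0 //; case: nex; exists t.
have nrm (T : finType) (C u : T -> R) s :
    \sum_t C t * (u t / s) = (\sum_t C t * u t) / s.
  by rewrite mulr_suml; apply: eq_bigr => t _; rewrite mulrA.
have pos k' : z k' != 0 -> 0 < z k' by move=> ?; rewrite lt_def z0 andbT.
have [[i zi] [j zj]] : (exists i, 0 < z (inl i)) /\ (exists j, 0 < z (inr j)).
  case: k zk => [i zi|j zj].
    split; first by exists i.
    by have := zge _ zi; rewrite MI => /supp [j /pos]; exists j.
  split; last by exists j.
  by have := zge _ zj; rewrite MJ => /supp [i /pos]; exists i.
have zI0 i' : 0 <= z (inl i') by [].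
have zJ0 j' : 0 <= z (inr j') by [].
exists (fun i => z (inl i) / \sum_i z (inl i)), (fun j => z (inr j) / \sum_j z (inr j)).
have sI := sumr_gt0 zI0 zi; have sJ := sumr_gt0 zJ0 zj.
split; [exact: distribution_normalize zi | exact: distribution_normalize zj | |].
- move=> i1 i2; rewrite pmulr_lgt0 ?invr_gt0 // => /zge; rewrite MI => ge1.
  rewrite !nrm mulrA ler_wpM2r ?invr_ge0 ?(ltW sJ) //.
  by rewrite -MI; apply: le_trans (zle _) _; rewrite ler_peMr // addr_ge0 ?ler01 // ltW.
- move=> j1 j2; rewrite pmulr_lgt0 ?invr_gt0 // => /zge; rewrite MJ => ge1.
  rewrite !nrm mulrA ler_wpM2r ?invr_ge0 ?(ltW sI) //.
  by rewrite -MJ; apply: le_trans (zle _) _; rewrite ler_peMr // addr_ge0 ?ler01 // ltW.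
Qed.

Lemma distribution_lim (T : finType) (U : set_system nat) (u : nat -> T -> R)
    (l : T -> R) :
  ProperFilter U -> (forall k, distribution (u k)) ->
  (forall t, (u k t @[k --> U] --> l t)%classic) -> distribution l.
Proof.
move=> PU du ul; split=> [t|].
  by apply: (cvgr_to_ge (ul t)); apply: filterE => k; case: (du k).
have lim : ((\sum_t u k t) @[k --> U] --> \sum_t l t)%classic by exact: cvg_sumr.
have sum1 : (fun k => \sum_t u k t) = (fun=> 1) by apply/funext => k; case: (du k).
by rewrite sum1 in lim; apply: (cvg_unique _ lim); [|exact: cvg_cst].
Qed.

(** An action in the support of the limit is in the support of the
    approximations from some point on. *)
Lemma best_reply_lim (S T : finType) (U : set_system nat) (eps : nat -> R)
    (x : nat -> S -> R) (y : nat -> T -> R) (x' : S -> R) (y' : T -> R)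
    (A : S -> T -> R) :
  ProperFilter U -> (eps k @[k --> U] --> (0 : R))%classic ->
  (forall k, best_reply (eps k) (x k) (y k) A) ->
  (forall s, (x k s @[k --> U] --> x' s)%classic) ->
  (forall t, (y k t @[k --> U] --> y' t)%classic) ->
  best_reply 0 x' y' A.
Proof.
move=> PU eps0 br xl yl s s' xs.
have lim r : (\sum_t A r t * y k t @[k --> U] --> \sum_t A r t * y' t)%classic.
  by apply: cvg_sumr => t; apply: cvgMr.
have lim2 : ((1 + eps k) * \sum_t A s t * y k t @[k --> U] -->
    (1 + 0) * \sum_t A s t * y' t)%classic.
  by apply: cvgM => //; apply: cvgD => //; exact: cvg_cst.
apply: (ler_cvg_to (lim s') lim2).
near=> k; apply: br; near: k.
exact: cvgr_gt (xl s) _ xs.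
Unshelve. all: by end_near.
Qed.

Theorem bimatrix_equilibrium (i0 : I) (j0 : J) (A : I -> J -> R) (B : J -> I -> R) :
  exists (x : I -> R) (y : J -> R), [/\ distribution x, distribution y,
    best_reply 0 x y A & best_reply 0 y x B].
Proof.
(* A constant added to all the payoffs makes them positive. *)
pose c := 1 + \sum_i \sum_j (`|A i j| + `|B j i|).
have AB0 i j : 0 < A i j + c /\ 0 < B j i + c.
  have row0 i' : 0 <= \sum_j' (`|A i' j'| + `|B j' i'|).
    by apply: sumr_ge0 => j' _; rewrite addr_ge0.
  have cell : `|A i j| + `|B j i| <= \sum_j' (`|A i j'| + `|B j' i|).
    by rewrite (bigD1 j) //= lerDl sumr_ge0 // => j' _; rewrite addr_ge0.
  have row_c : \sum_j' (`|A i j'| + `|B j' i|) <= c - 1.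
    by rewrite /c [leRHS]addrAC subrr add0r (bigD1 i) //= lerDl sumr_ge0.
  have := ler_norm (- A i j); have := ler_norm (- B j i); rewrite !normrN.
  have := normr_ge0 (A i j); have := normr_ge0 (B j i).
  by move=> *; split; lra.
have shift (S T : finType) (C : S -> T -> R) x (y : T -> R) : distribution y ->
    best_reply 0 x y (fun s t => C s t + c) -> best_reply 0 x y C.
  move=> [_ y1] br s s' xs; have := br s s' xs; rewrite addr0 !mul1r.
  under eq_bigr do rewrite mulrDl; under [leRHS]eq_bigr do rewrite mulrDl.
  by rewrite !big_split /= lerD2r.
have [xy xyP] := choice (fun k : nat => approximate_bimatrix_equilibrium i0 j0
  (fun i j => (AB0 i j).1) (fun j i => (AB0 i j).2) (harmonic_gt0 k)).
have [y yP] := choice xyP.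
have dx k : distribution (xy k) by have [] := yP k.
have dy k : distribution (y k) by have [] := yP k.
have [U [UU freeU]] := free_ultrafilter.
have bnd (T : finType) (u : T -> R) t : distribution u -> `|u t| <= 1.
  by move=> du; rewrite ger0_norm ?distribution_le1 //; case: du.
have [x' xx'] := ultra_cvg_family UU (fun k i => bnd _ _ i (dx k)).
have [y' yy'] := ultra_cvg_family UU (fun k j => bnd _ _ j (dy k)).
have harm0 : (harmonic k @[k --> U] --> (0 : R))%classic.
  by apply: cvg_trans cvg_harmonic; exact: cvg_app.
have dx' : distribution x' by exact: distribution_lim dx xx'.
have dy' : distribution y' by exact: distribution_lim dy yy'.
exists x', y'; split=> //; apply: shift => //.
  by apply: (best_reply_lim _ harm0 _ xx' yy') => k; have [] := yP k.
by apply: (best_reply_lim _ harm0 _ yy' xx') => k; have [] := yP k.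
Qed.

End Bimatrix.

(** * Discounted Markov chains *)

Section Discount.
Variables (R : realType) (n : nat).
Implicit Types (P Q X N : 'M[R]_n) (r u v w : 'cV[R]_n) (theta : R).

Lemma addmxE (A B : 'M[R]_(n, 1)) i j : (A + B) i j = A i j + B i j.
Proof. by rewrite mxE. Qed.

Lemma oppmxE (A : 'M[R]_(n, 1)) i j : (- A) i j = - A i j.
Proof. by rewrite mxE. Qed.

Lemma scalemxE a (A : 'M[R]_(n, 1)) i j : (a *: A) i j = a * A i j.
Proof. by rewrite mxE. Qed.

Let linE := (addmxE, oppmxE, scalemxE).

(** Minimum principle, at a least coordinate of [w]. *)
Lemma discount_comparison P w theta : stochastic P -> 0 < theta <= 1 ->
  (forall i, (1 - theta) * (P *m w) i 0 <= w i 0) -> forall i, 0 <= w i 0.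
Proof.
move=> [P0 P1] /andP[t0 t1] le_w i.
case: (@arg_minP _ _ _ i xpredT (fun k => w k 0) isT) => m _ min_m.
apply: le_trans (min_m i isT).
have : w m 0 <= (P *m w) m 0.
  rewrite mxE -[leLHS]mul1r -(P1 m) mulr_suml ler_sum // => k _.
  by rewrite ler_wpM2l // min_m.
rewrite -subr_ge0 => /(mulr_ge0 (_ : 0 <= 1 - theta)); rewrite subr_ge0 => /(_ t1) Pw.
rewrite -(pmulr_rge0 _ t0); have := le_w m; lra.
Qed.

Lemma resolvent P theta : stochastic P -> 0 < theta <= 1 ->
  exists N, [/\ N *m (1%:M - (1 - theta) *: P) = 1%:M,
    forall i j, 0 <= N i j & forall i, 0 < N i i].
Proof.
move=> Pst t01; pose A : 'M[R]_n := 1%:M - (1 - theta) *: P.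
have AE w : A *m w = w - (1 - theta) *: (P *m w).
  by rewrite mulmxBl mul1mx -scalemxAl.
have A_ge0 w : (forall i, 0 <= (A *m w) i 0) -> forall i, 0 <= w i 0.
  move=> Aw; apply: (discount_comparison Pst t01) => i; have := Aw i.
  by rewrite AE !linE subr_ge0.
have Au : A \in unitmx.
  rewrite -unitmx_tr -row_free_unit; apply: inj_row_free => v vA.
  have Av : A *m v^T = 0 by rewrite -[A]trmxK -trmx_mul vA trmx0.
  apply: trmx_inj; apply/colP => i; rewrite trmx0 [RHS]mxE.
  apply/eqP; rewrite eq_le; apply/andP; split.
    rewrite -oppr_ge0; rewrite -oppmxE; apply: A_ge0 => k.
    by rewrite mulmxN Av oppr0 mxE.
  by apply: A_ge0 => k; rewrite Av mxE.
have N0 j i : 0 <= col j (invmx A) i 0.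
  apply: A_ge0 => k; rewrite colE mulmxA mulmxV // mul1mx mxE.
  exact: ler0n.
exists (invmx A); split=> [|i j|i]; first exact: mulVmx.
  by have := N0 j i; rewrite mxE.
have : (A *m col i (invmx A)) i 0 = 1 by rewrite colE mulmxA mulmxV // mul1mx mxE !eqxx.
rewrite AE !linE [X in X - _]mxE => E.
have : 0 <= (1 - theta) * (P *m col i (invmx A)) i 0.
  have /andP[_ t1] := t01; rewrite mulr_ge0 ?subr_ge0 //.
  rewrite mxE; apply: sumr_ge0 => k _; apply: mulr_ge0 => //; by case: Pst.
lra.
Qed.

(** With [h = X r] and [c] a bound of [h], the vector [Q r + theta (h - c)] is a
    subsolution of the discounted equation: the error is
    [theta ^ 2 (P h - c) <= 0]. *)
Lemma supersolution_ge P Q X r v theta c : stochastic P -> ergodic P Q X ->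
  0 < theta <= 1 -> (forall i, `|(X *m r) i 0| <= c) ->
  (forall i, theta * r i 0 + (1 - theta) * (P *m v) i 0 <= v i 0) ->
  forall i, (Q *m r) i 0 - theta * c *+ 2 <= v i 0.
Proof.
move=> Pst [_ PQ _ eqX] t01 hc vsup i.
pose h := X *m r; pose w := Q *m r + theta *: (h - const_mx c).
have rE : r = Q *m r + (h - P *m h).
  rewrite -[h in h - _]mul1mx -mulmxBl mulmxA -eqX mulmxBl mul1mx.
  by rewrite addrC subrK.
have PwE : P *m w = Q *m r + theta *: (P *m h - const_mx c).
  by rewrite /w mulmxDr mulmxA PQ -scalemxAr mulmxBr stochastic_const.
have /(_ i) : forall i, 0 <= (v - w) i 0.
  apply: (discount_comparison Pst t01) => k.
  have Ph := stochastic_norm Pst hc k; have := vsup k.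
  have rk : r k 0 = (Q *m r) k 0 + (h k 0 - (P *m h) k 0).
    by rewrite {1}rE !linE.
  have -> : (P *m (v - w)) k 0 =
      (P *m v) k 0 - ((Q *m r) k 0 + theta * ((P *m h) k 0 - c)).
    by rewrite mulmxBr PwE !linE [const_mx c k 0]mxE.
  have -> : (v - w) k 0 = v k 0 - ((Q *m r) k 0 + theta * (h k 0 - c)).
    by rewrite !linE [const_mx c k 0]mxE.
  rewrite rk => vk; move: Ph; rewrite -/h ler_norml => /andP[_ Ph].
  have /andP[t0 _] := t01.
  have : 0 <= theta * (theta * (c - (P *m h) k 0)).
    by rewrite !mulr_ge0 ?subr_ge0 // ltW.
  lra.
have := hc i; rewrite -/h ler_norml => /andP[hi _].
have -> : (v - w) i 0 = v i 0 - ((Q *m r) i 0 + theta * (h i 0 - c)).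
  by rewrite !linE [const_mx c i 0]mxE.
have /andP[t0 _] := t01.
have : 0 <= theta * (h i 0 + c) by rewrite mulr_ge0 ?(ltW t0) //; lra.
lra.
Qed.

Lemma subsolution_le P Q X r v theta c : stochastic P -> ergodic P Q X ->
  0 < theta <= 1 -> (forall i, `|(X *m r) i 0| <= c) ->
  (forall i, v i 0 <= theta * r i 0 + (1 - theta) * (P *m v) i 0) ->
  forall i, v i 0 <= (Q *m r) i 0 + theta * c *+ 2.
Proof.
move=> Pst erg t01 hc vsub i.
have Xr k : `|(X *m - r) k 0| <= c by rewrite mulmxN oppmxE normrN.
have := @supersolution_ge P Q X (- r) (- v) theta c Pst erg t01 Xr _ i.
rewrite !mulmxN !oppmxE => sup.
have : (- (Q *m r) i 0) - theta * c *+ 2 <= - v i 0.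
  by apply: sup => k; rewrite ?mulmxN !oppmxE; have := vsub k; lra.
lra.
Qed.

End Discount.

(** * Payoffs of games controlled by player 2 *)

Lemma average_le (R : realType) (I : finType) (x a : I -> R) m :
  distribution x -> (forall i, a i <= m) -> \sum_i x i * a i <= m.
Proof.
move=> [x0 x1] am; rewrite -[leRHS]mul1r -x1 mulr_suml.
by apply: ler_sum => i _; apply: ler_wpM2l.
Qed.

Lemma average_eq (R : realType) (I : finType) (x a : I -> R) m :
  distribution x -> (forall i, 0 < x i -> a i = m) -> \sum_i x i * a i = m.
Proof.
move=> [x0 x1] am; rewrite -[RHS]mul1r -x1 mulr_suml; apply: eq_bigr => i _.
have [->|xi] := eqVneq (x i) 0; first by rewrite !mul0r.
by rewrite am // lt_def xi x0.
Qed.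

Lemma average_max (R : realType) (I : finType) (x a : I -> R) m :
  distribution x -> (forall i, a i <= m) -> m <= \sum_i x i * a i ->
  forall i, 0 < x i -> a i = m.
Proof.
move=> [x0 x1] am; rewrite -[leLHS]mul1r -x1 mulr_suml -subr_ge0 -sumrB => sum_ge0 i xi.
have pos j : 0 <= x j * m - x j * a j by rewrite -mulrBr mulr_ge0 ?subr_ge0.
have /eqP : \sum_j (x j * m - x j * a j) = 0.
  apply/eqP; rewrite eq_le sumr_ge0 // andbT -oppr_ge0 -sumrN.
  by under eq_bigr do rewrite opprB.
rewrite psumr_eq0 // => /allP/(_ i (mem_index_enum _)) /=.
by rewrite -mulrBr mulf_eq0 (gt_eqF xi) /= subr_eq0 => /eqP.
Qed.

Section Game.
Variables (R : realType) (K : nat) (G : stochastic_game R K).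
Implicit Types (f : strategy G P1) (g : strategy G P2) (v h : 'cV[R]_K).

Definition action1 s : 'I_(actions G P1 s) := Ordinal (actions_gt0 G P1 s).

(** The expectation of [v] at the next state. The transitions are read off at an
    arbitrary action of player 1, which is faithful in a game controlled by
    player 2. *)
Definition continuation s (j : 'I_(actions G P2 s)) v : R :=
  \sum_t transition G s (action1 s) j t * v t 0.

Definition law g : 'M[R]_K :=
  \matrix_(s, t) \sum_j g s 0 j * transition G s (action1 s) j t.

Definition rewards k f g : 'cV[R]_K := \col_s stage_reward k f g s.

Definition reward_row g s (i : 'I_(actions G P1 s)) : R :=
  \sum_j reward G P1 s i j * g s 0 j.

Definition reward_col f s (j : 'I_(actions G P2 s)) : R :=
  \sum_i f s 0 i * reward G P2 s i j.

Definition plays_best_reply f g s :=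
  best_reply 0 (f s 0) (g s 0) (fun i j => reward G P1 s i j).

Lemma plays_best_replyP f g s : plays_best_reply f g s <->
  forall i i' : 'I_(actions G P1 s), 0 < f s 0 i -> reward_row g i' <= reward_row g i.
Proof.
split=> br i i' fi; have := br i i' fi; rewrite /reward_row.
  by rewrite addr0 mul1r.
by rewrite addr0 mul1r.
Qed.

Lemma rewards1E f g s : rewards P1 f g s 0 = \sum_i f s 0 i * reward_row g i.
Proof.
rewrite mxE; apply: eq_bigr => i _; rewrite mulr_sumr.
by apply: eq_bigr => j _; rewrite -mulrA (mulrC (g s 0 j)).
Qed.

Lemma rewards2E f g s : rewards P2 f g s 0 = \sum_j g s 0 j * reward_col f j.
Proof.
rewrite mxE /stage_reward exchange_big; apply: eq_bigr => j _; rewrite mulr_sumr.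
by apply: eq_bigr => i _; rewrite mulrAC mulrC.
Qed.

Lemma lawM g v s : (law g *m v) s 0 = \sum_j g s 0 j * continuation j v.
Proof.
rewrite mxE; under eq_bigr do rewrite mxE mulr_suml.
rewrite exchange_big; apply: eq_bigr => j _; rewrite mulr_sumr.
by apply: eq_bigr => t _; rewrite mulrA.
Qed.

Lemma law_stochastic g : stationary g -> stochastic (law g).
Proof.
move=> gst; split=> [s t|s].
  rewrite mxE sumr_ge0 // => j _.
  by rewrite mulr_ge0 ?transition_ge0 //; case: (gst s).
under eq_bigr do rewrite mxE.
rewrite exchange_big -[RHS](gst s).2; apply: eq_bigr => j _.
by rewrite -mulr_sumr transition_sum1 mulr1.
Qed.

Definition pure k (a : forall s, 'I_(actions G k s)) : strategy G k :=
  fun s => delta_mx 0 (a s).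

Lemma pure_distribution n (j : 'I_n) :
  distribution ((delta_mx 0 j : 'rV[R]_n) 0).
Proof.
split=> [i|]; first by rewrite mxE ler0n.
rewrite (bigD1 j) //= big1 => [|i ij]; first by rewrite mxE !eqxx addr0.
by rewrite mxE (negPf ij).
Qed.

Lemma sum_pure n (j : 'I_n) (c : 'I_n -> R) :
  \sum_i (delta_mx 0 j : 'rV[R]_n) 0 i * c i = c j.
Proof.
rewrite (bigD1 j) //= big1 => [|i ij]; first by rewrite mxE !eqxx mul1r addr0.
by rewrite mxE (negPf ij) mul0r.
Qed.

Lemma update_stationary k (a : strategy G k) s (x : 'rV_(actions G k s)) :
  stationary a -> distribution (x 0) -> stationary (dfwith a s x).
Proof.
move=> ast xd t; case: dfwithP => [|u _]; first exact: xd.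
exact: ast.
Qed.

Section Controlled.
Hypothesis controlled : player2_controlled G.

Lemma transition_lawE f g : stationary f -> transition_mx f g = law g.
Proof.
move=> fst; apply/matrixP => s t; rewrite !mxE exchange_big /=.
apply: eq_bigr => j _.
rewrite -[RHS]mul1r -(fst s).2 mulr_suml; apply: eq_bigr => i _.
by rewrite mulrA (controlled i (action1 s)).
Qed.

Lemma undiscounted_payoffE k f g Q X s : stationary f -> stationary g ->
  ergodic (law g) Q X ->
  undiscounted_payoff k f g s = (Q *m rewards k f g) s 0.
Proof.
move=> fst gst [_ PQ _ eqX].
have day n : day_reward k n f g s = (law g ^+ n *m rewards k f g) s 0.
  rewrite /day_reward transition_lawE // mxE; apply: eq_bigr => t _.
  by rewrite [rewards _ _ _ _ _]mxE.
have := @cesaro_cvg _ _ _ _ _ (rewards k f g) s (law_stochastic gst) PQ eqX.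
under eq_fun do under eq_bigr do rewrite -day.
by rewrite /undiscounted_payoff => /cvg_limn_inf_sup [-> _].
Qed.

(** The payoff of player 1 at [s] is the sum of the rewards weighted by the row
    [s] of [Q], and a deviation at [t] changes the term [Q s t] only. *)
Lemma optimal1P f g Q X : stationary f -> stationary g -> ergodic (law g) Q X ->
  (forall f', stationary f' -> forall s,
     undiscounted_payoff P1 f' g s <= undiscounted_payoff P1 f g s) <->
  (forall s t, 0 < Q s t -> plays_best_reply f g t).
Proof.
move=> fst gst erg; have [[Q0 _] _ _ _] := erg; split=> [opt s t Qst|br f' f'st s].
  have max (i : 'I_(actions G P1 t)) : reward_row g i <= rewards P1 f g t 0.
    pose f' := dfwith f t (delta_mx 0 i : 'rV[R]_(actions G P1 t)).
    have f'st : stationary f' by apply: update_stationary => //; exact: pure_distribution.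
    have := opt f' f'st s; rewrite !(undiscounted_payoffE _ _ _ _ erg) //.
    rewrite [leLHS]mxE [leRHS]mxE -subr_ge0 -sumrB (bigD1 t) //= big1 => [|u ut].
      rewrite addr0 -mulrBr pmulr_rge0 // subr_ge0 rewards1E.
      by rewrite /f' dfwithin sum_pure.
    by rewrite -mulrBr !rewards1E /f' dfwithout 1?eq_sym // subrr mulr0.
  apply/plays_best_replyP => i i' fi.
  suff <- : rewards P1 f g t 0 = reward_row g i by [].
  apply/esym; apply: (average_max (fst t) max) fi.
  by rewrite -rewards1E.
rewrite !(undiscounted_payoffE _ _ _ _ erg) // [leLHS]mxE [leRHS]mxE.
apply: ler_sum => t _.
have [Qst|] := ltP 0 (Q s t); last first.
  by rewrite le_eqVlt ltNge Q0 orbF => /eqP ->; rewrite !mul0r.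
apply: ler_wpM2l => //.
have /plays_best_replyP brt := br s t Qst.
have [i fi] := distribution_supp (fst t).
rewrite !rewards1E [leRHS](@average_eq _ _ _ _ (reward_row g i) (fst t)).
  by apply: average_le (f'st t) _ => i'; apply: brt.
by move=> i' fi'; apply/eqP; rewrite eq_le !brt.
Qed.

End Controlled.
End Game.

(** * Existence of an equilibrium *)

Section Existence.
Variables (R : realType) (K : nat) (G : stochastic_game R K).
Implicit Types (f : strategy G P1) (g : strategy G P2) (v : 'cV[R]_K).

Notation plan k := {dffun forall s : 'I_K, 'I_(actions G k s)}.

Definition first_plan k : plan k := [ffun s => Ordinal (actions_gt0 G k s)].

Definition deviate k (a : plan k) s (i : 'I_(actions G k s)) : plan k :=
  [ffun t => dfwith a s i t].

(** The conditional law of the action at [s] when the plan is drawn from [x] and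
    a plan [a] visits [s] with the weight [z a s]. *)
Definition behavior k (x : plan k -> R) (z : plan k -> 'I_K -> R) : strategy G k :=
  fun s => \row_i ((\sum_(a : plan k | a s == i) x a * z a s) / \sum_a x a * z a s).

Lemma behavior_sum k (x : plan k -> R) z s (c : 'I_(actions G k s) -> R) :
  \sum_i behavior x z s 0 i * c i =
  (\sum_a x a * z a s * c (a s)) / \sum_a x a * z a s.
Proof.
rewrite (partition_big (fun a : plan k => a s) xpredT) //= mulr_suml.
apply: eq_bigr => i _; rewrite mxE mulrAC; congr (_ / _).
by rewrite mulr_suml; apply: eq_bigr => a /eqP ->.
Qed.

Lemma behavior_stationary k (x : plan k -> R) z : distribution x ->
  (forall a s, 0 < z a s) -> stationary (behavior x z).
Proof.
move=> dx z0 s.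
have xz a : 0 <= x a * z a s by rewrite mulr_ge0 ?(ltW (z0 _ _)) //; case: dx.
have [a xa] := distribution_supp dx.
have tot : 0 < \sum_a x a * z a s by apply: (@sumr_gt0 _ _ _ a) => //; exact: mulr_gt0.
split=> [i|]; first by rewrite mxE divr_ge0 ?(ltW tot) // sumr_ge0.
have := @behavior_sum k x z s (fun=> 1).
under eq_bigr do rewrite mulr1.
by under [in RHS]eq_bigr do rewrite mulr1; rewrite divff // gt_eqF.
Qed.

Lemma behavior_supp k (x : plan k -> R) z s i : distribution x ->
  (forall a s, 0 < z a s) -> 0 < behavior x z s 0 i ->
  exists2 a : plan k, a s = i & 0 < x a.
Proof.
move=> [x0 _] z0 bi; apply: contrapT => nex; move: bi.
rewrite mxE big1 ?mul0r ?ltxx // => a /eqP ai.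
suff -> : x a = 0 by rewrite mul0r.
apply/eqP; rewrite eq_le x0 andbT leNgt; apply/negP => xa.
by apply: nex; exists a.
Qed.

(** When payoffs add up over the states, a plan in the support is optimal at
    each state: compare it with its deviation at [s]. *)
Lemma best_reply_at k (T : finType) (x : plan k -> R) (y : T -> R)
    (h : forall s, 'I_(actions G k s) -> T -> R) (a : plan k) s i :
  best_reply 0 x y (fun a t => \sum_s h s (a s) t) -> 0 < x a ->
  \sum_t h s i t * y t <= \sum_t h s (a s) t * y t.
Proof.
move=> br xa; have := br a (deviate a i) xa; rewrite addr0 mul1r.
have E (b : plan k) : \sum_t (\sum_s h s (b s) t) * y t = \sum_s \sum_t h s (b s) t * y t.
  by rewrite exchange_big; apply: eq_bigr => t _; rewrite mulr_suml.
rewrite !E (bigD1 s) // [leRHS](bigD1 s) //= !ffunE dfwithin.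
rewrite [X in _ + X <= _](eq_bigr (fun s => \sum_t h s (a s) t * y t)) ?lerD2r // => u us.
by rewrite ffunE dfwithout // eq_sym.
Qed.

Hypothesis controlled : player2_controlled G.

(** The equilibrium of the bimatrix game between plans in which a day in [s] is
    weighted by the discounted time spent there from a uniform initial state.
    These weights depend on the plan of player 2 only. *)
Theorem discounted_equilibrium (theta : R) : 0 < theta <= 1 ->
  exists f g v, [/\ stationary f, stationary g, forall s, plays_best_reply f g s,
    forall s (j : 'I_(actions G P2 s)),
      theta * reward_col f j + (1 - theta) * continuation j v <= v s 0 &
    forall s (j : 'I_(actions G P2 s)), 0 < g s 0 j ->
      v s 0 = theta * reward_col f j + (1 - theta) * continuation j v].
Proof.
move=> t01; have /andP[t0 t1] := t01.
have pure_st k (a : plan k) : stationary (pure a) by move=> s; exact: pure_distribution.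
have [N NP] := choice (fun b : plan P2 => resolvent (law_stochastic (pure_st _ b)) t01).
pose z b s := \sum_u N b u s.
have z_gt0 b s : 0 < z b s.
  have [_ N0 Nd] := NP b; apply: (@sumr_gt0 _ _ _ s) => // u; exact: N0.
pose A (a : plan P1) (b : plan P2) : R := \sum_s z b s * reward G P1 s (a s) (b s).
pose B (b : plan P2) (a : plan P1) : R := \sum_s z b s * reward G P2 s (a s) (b s).
have [x [y [dx dy brx bry]]] :=
  bimatrix_equilibrium (first_plan P1) (first_plan P2) A B.
pose f := behavior x (fun _ _ => 1); pose g := behavior y z.
have fst : stationary f by apply: behavior_stationary => // _ _; exact: ltr01.
have gst : stationary g by exact: behavior_stationary.
(* [U b] is the discounted value of the plan [b] against [f], [V b] its total. *)
pose rho (b : plan P2) : 'cV[R]_K := \col_s (theta * reward_col f (b s)).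
pose U b := N b *m rho b.
pose excess (b : plan P2) v : 'cV[R]_K :=
  \col_s (theta * reward_col f (b s) + (1 - theta) * continuation (b s) v - v s 0).
have excessE b v : excess b v = rho b - (1%:M - (1 - theta) *: law (pure b)) *m v.
  apply/colP => u; rewrite mulmxBl mul1mx -scalemxAl !(addmxE, oppmxE, scalemxE).
  by rewrite lawM /pure sum_pure !mxE; ring.
have U_sub b v : U b - v = N b *m excess b v.
  by have [NA _ _] := NP b; rewrite excessE mulmxBr mulmxA NA mul1mx.
have excessU b : excess b (U b) = 0.
  by have [/mulmx1C NA _ _] := NP b; rewrite excessE mulmxA NA mul1mx subrr.
have total b v : \sum_s (U b - v) s 0 = \sum_s z b s * excess b v s 0.
  under eq_bigr do rewrite U_sub mxE.
  by rewrite exchange_big; apply: eq_bigr => s _; rewrite mulr_suml.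
pose V b := \sum_s U b s 0.
have VE b : theta * (\sum_a B b a * x a) = V b.
  have := total b 0; under eq_bigr do rewrite subr0; rewrite -/(V b) => ->.
  under eq_bigr do rewrite mulr_suml.
  rewrite exchange_big mulr_sumr; apply: eq_bigr => s _.
  rewrite [excess _ _ _ _]mxE [X in _ - X]mxE subr0.
  rewrite [continuation _ _]big1 => [|u _]; last by rewrite mxE mulr0.
  rewrite mulr0 addr0 /reward_col behavior_sum.
  under [in RHS]eq_bigr do rewrite mulr1.
  rewrite [X in _ / X](_ : _ = 1) ?divr1; last first.
    by under eq_bigr do rewrite mulr1; case: dx.
  rewrite mulrCA; congr (_ * _); rewrite mulr_sumr; apply: eq_bigr => a _; ring.
have Vmax b b' : 0 < y b -> V b' <= V b.
  move=> yb; rewrite -!VE ler_wpM2l ?(ltW t0) //.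
  by have := bry b b' yb; rewrite addr0 mul1r.
have [b0 yb0] := distribution_supp dy; pose v := U b0.
have total_sub b : V b - V b0 = \sum_s z b s * excess b v s 0.
  by rewrite -total /V -sumrB; apply: eq_bigr => u _; rewrite addmxE oppmxE.
have le_v s (j : 'I_(actions G P2 s)) :
    theta * reward_col f j + (1 - theta) * continuation j v <= v s 0.
  rewrite -subr_le0 leNgt; apply/negP => gain.
  pose b' := deviate b0 j.
  have := Vmax b0 b' yb0; rewrite -subr_le0 leNgt => /negP; apply.
  rewrite total_sub (bigD1 s) //= big1 => [|u us].
    by rewrite addr0 mulr_gt0 // mxE /b' ffunE dfwithin.
  have -> : excess b' v u 0 = excess b0 v u 0.
    by rewrite [LHS]mxE [RHS]mxE /b' ffunE dfwithout // eq_sym.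
  by rewrite excessU mxE mulr0.
exists f, g, v; split=> // [s|s j gj].
  apply/plays_best_replyP => i i' /(behavior_supp dx (fun _ _ => ltr01)) [a <- xa].
  have := @best_reply_at P1 _ x y
    (fun s i b => z b s * reward G P1 s i (b s)) a s i' brx xa.
  have rowE i1 : reward_row g i1 =
      (\sum_b z b s * reward G P1 s i1 (b s) * y b) / \sum_b y b * z b s.
    rewrite /reward_row; under eq_bigr do rewrite mulrC.
    by rewrite behavior_sum; congr (_ / _); apply: eq_bigr => b _; ring.
  rewrite !rowE ler_pM2r // invr_gt0.
  have [b yb] := distribution_supp dy.
  apply: (@sumr_gt0 _ _ _ b) => [b'|]; last exact: mulr_gt0.
  by rewrite mulr_ge0 ?(ltW (z_gt0 _ _)) //; case: dy.
have [b bj yb] := behavior_supp dy z_gt0 gj.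
have Vb : V b = V b0 by apply/eqP; rewrite eq_le !Vmax.
have /eqP : \sum_u z b u * - excess b v u 0 = 0.
  under eq_bigr do rewrite mulrN.
  by rewrite sumrN -total_sub Vb subrr oppr0.
rewrite psumr_eq0 => [|u _]; last first.
  by rewrite mulr_ge0 ?(ltW (z_gt0 _ _)) // mxE oppr_ge0 subr_le0.
move=> /allP/(_ s (mem_index_enum _)); rewrite mulf_eq0 (gt_eqF (z_gt0 _ _)) /=.
by rewrite oppr_eq0 mxE subr_eq0 bj => /eqP ->.
Qed.


Section Limit.
Local Open Scope classical_set_scope.

Lemma rewards_cvg (U : set_system nat) (F : nat -> strategy G P1) f g s :
  ProperFilter U -> (forall t i, F k t 0 i @[k --> U] --> f t 0 i) ->
  rewards P2 (F k) g s 0 @[k --> U] --> rewards P2 f g s 0.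
Proof.
move=> PU Ff; rewrite mxE; under eq_fun do rewrite mxE.
apply: cvg_sumr => i; apply: cvg_sumr => j.
by do 2 apply: cvgMl; exact: Ff.
Qed.

Lemma mulmx_col_cvg (U : set_system nat) (M : 'M[R]_K) (u : nat -> 'cV[R]_K) v s :
  ProperFilter U -> (forall t, u k t 0 @[k --> U] --> v t 0) ->
  (M *m u k) s 0 @[k --> U] --> (M *m v) s 0.
Proof.
move=> PU uv; rewrite mxE; under eq_fun do rewrite mxE.
by apply: cvg_sumr => t; apply: cvgMr; exact: uv.
Qed.

(** The limit of discounted equilibria as the discount rate vanishes. The
    limit plan of player 2 uses only actions that were optimal before the limit,
    hence solves the same discounted equations as the approximating plans. *)
Theorem equilibrium_exists : exists f g, nash_equilibrium f g.
Proof.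
have th01 k : 0 < (harmonic k : R) <= 1.
  by rewrite harmonic_gt0 /= invf_le1 ?ltr0n // ler1n.
have [f_ f_P] := choice (fun k => discounted_equilibrium (th01 k)).
have [g_ g_P] := choice f_P; have [v_ v_P] := choice g_P.
have fst_ k : stationary (f_ k) by have [] := v_P k.
have gst_ k : stationary (g_ k) by have [] := v_P k.
have [U [UU freeU]] := free_ultrafilter.
have bnd p (a : strategy G p) s i : stationary a -> `|a s 0 i| <= 1.
  by move=> ast; rewrite ger0_norm ?(distribution_le1 i (ast s)) //; case: (ast s).
have [lf lfP] := @ultra_cvg_family R {s : 'I_K & 'I_(actions G P1 s)} U
  (fun k t => f_ k (tag t) 0 (tagged t)) 1 UU (fun k t => bnd _ _ _ _ (fst_ k)).
have [lg lgP] := @ultra_cvg_family R {s : 'I_K & 'I_(actions G P2 s)} U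
  (fun k t => g_ k (tag t) 0 (tagged t)) 1 UU (fun k t => bnd _ _ _ _ (gst_ k)).
pose f : strategy G P1 := fun s => \row_i lf (existT _ s i).
pose g : strategy G P2 := fun s => \row_j lg (existT _ s j).
have f_cvg s i : f_ k s 0 i @[k --> U] --> f s 0 i.
  by rewrite mxE; exact: (lfP (existT _ s i)).
have g_cvg s j : g_ k s 0 j @[k --> U] --> g s 0 j.
  by rewrite mxE; exact: (lgP (existT _ s j)).
have fst : stationary f.
  by move=> s; apply: (distribution_lim _ (fun k => fst_ k s) (f_cvg s)).
have gst : stationary g.
  by move=> s; apply: (distribution_lim _ (fun k => gst_ k s) (g_cvg s)).
have harm0 : harmonic k @[k --> U] --> (0 : R).
  by apply: cvg_trans cvg_harmonic; exact: cvg_app.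
have [Q [X erg]] := ergodic_projection (law_stochastic gst).
exists f, g; split=> //.
  apply/(optimal1P controlled fst gst erg) => _ t _.
  apply: (best_reply_lim _ (cvg_cst (0 : R)) _ (f_cvg t) (g_cvg t)) => k.
  by have [_ _ br _ _] := v_P k; exact: br.
move=> g' g'st s.
have [Q' [X' erg']] := ergodic_projection (law_stochastic g'st).
rewrite !(undiscounted_payoffE controlled _ _ fst _ erg) //
  (undiscounted_payoffE controlled _ _ fst _ erg') //.
pose r_ k := rewards P2 (f_ k) g; pose r'_ k := rewards P2 (f_ k) g'.
pose err (Y : 'M[R]_K) (u : 'cV[R]_K) : R := \sum_i `|(Y *m u) i 0|.
have errP (Y : 'M[R]_K) (u : 'cV[R]_K) i :
    `|(Y *m u) i 0| <= err Y u.
  by rewrite /err (bigD1 i) //= lerDl sumr_ge0.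
have err_cvg (Y : 'M[R]_K) g1 :
    harmonic k * err Y (rewards P2 (f_ k) g1) *+ 2 @[k --> U] --> (0 : R).
  have -> : (0 : R) = 0 * err Y (rewards P2 f g1) + 0 * err Y (rewards P2 f g1).
    by rewrite mul0r addr0.
  have cvg_err : err Y (rewards P2 (f_ k) g1) @[k --> U] --> err Y (rewards P2 f g1).
    apply: cvg_sumr => i; apply: cvg_norm; apply: mulmx_col_cvg => t.
    exact: rewards_cvg.
  by under eq_fun do rewrite mulr2n; apply: cvgD; apply: cvgM.
have lower k : (Q' *m r'_ k) s 0 - harmonic k * err X' (r'_ k) *+ 2 <= v_ k s 0.
  apply: (supersolution_ge (law_stochastic g'st) erg' (th01 k) (errP _ _)) => t.
  have [_ _ _ sup _] := v_P k.
  rewrite rewards2E lawM !mulr_sumr -big_split /=.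
  under eq_bigr do rewrite mulrCA [X in _ + X]mulrCA -mulrDr.
  exact: average_le (g'st t) (sup t).
have upper : \forall k \near U,
    v_ k s 0 <= (Q *m r_ k) s 0 + harmonic k * err X (r_ k) *+ 2.
  have supp : \forall k \near U, forall t j, 0 < g t 0 j -> 0 < g_ k t 0 j.
    apply: filter_forall => t; apply: filter_forall => j.
    have [gj|gj] := ltP 0 (g t 0 j); last exact: filterE.
    by apply: filterS (cvgr_gt _ (g_cvg t j) _ gj) => k gkj _.
  apply: filterS supp => k supp.
  apply: (subsolution_le (law_stochastic gst) erg (th01 k) (errP _ _)) => t.
  have [_ _ _ _ eqv] := v_P k.
  rewrite rewards2E lawM !mulr_sumr -big_split /=.
  under eq_bigr do rewrite mulrCA [X in _ + X]mulrCA -mulrDr.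
  by rewrite (@average_eq _ _ _ _ (v_ k t 0) (gst t)) // => j /supp /eqv <-.
have limQ' : (Q' *m r'_ k) s 0 - harmonic k * err X' (r'_ k) *+ 2 @[k --> U] -->
    (Q' *m rewards P2 f g') s 0 - 0.
  by apply: cvgB (err_cvg X' g'); apply: mulmx_col_cvg => t; exact: rewards_cvg.
have limQ : (Q *m r_ k) s 0 + harmonic k * err X (r_ k) *+ 2 @[k --> U] -->
    (Q *m rewards P2 f g) s 0 + 0.
  by apply: cvgD (err_cvg X g); apply: mulmx_col_cvg => t; exact: rewards_cvg.
rewrite subr0 in limQ'; rewrite addr0 in limQ.
apply: (ler_cvg_to limQ' limQ).
by apply: filterS upper => k; exact: le_trans.
Qed.

End Limit.
End Existence.

(** * Uniqueness of the equilibrium *)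

Section ErgodicFacts.
Variables (R : realType) (n : nat) (P Q X : 'M[R]_n).
Hypotheses (Pst : stochastic P) (erg : ergodic P Q X).

Lemma ergodic_fixed (v : 'cV[R]_n) : P *m v = v -> Q *m v = v.
Proof.
have [_ PQ _ eqX] := erg => Pv.
have E : v - Q *m v = (1%:M - P) *m (X *m v) by rewrite mulmxA -eqX mulmxBl mul1mx.
have : (1%:M - P) *m (X *m v) = 0.
  by apply: stochastic_ker_im => //; rewrite -E mulmxBl mul1mx mulmxBr mulmxA PQ Pv subrr.
by rewrite -E => /eqP; rewrite subr_eq0 => /eqP.
Qed.

Lemma ergodic_invariant m (mu : 'M[R]_(m, n)) : mu *m P = mu -> mu *m Q = mu.
Proof.
have [_ _ _ eqX] := erg => muP.
apply/eqP; rewrite eq_sym -subr_eq0 -[X in X - _]mulmx1 -mulmxBr eqX mulmxA.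
by rewrite mulmxBr mulmx1 muP subrr mul0mx.
Qed.

(** [y >= P ^ k y] for all [k]; average. *)
Lemma ergodic_superharmonic (y : 'cV[R]_n) :
  (forall i, (P *m y) i 0 <= y i 0) -> forall i, (Q *m y) i 0 <= y i 0.
Proof.
move=> Py i; have [_ PQ _ eqX] := erg.
apply: (cvgr_to_le (@cesaro_cvg _ _ _ _ _ y i Pst PQ eqX)).
apply: nearW => N; rewrite ler_pdivrMl ?ltr0n // mulr_natl.
have Pk k : (P ^+ k *m y) i 0 <= y i 0.
  elim: k i => [|k IHk] i; first by rewrite expr0 mul1mx.
  rewrite exprS -mulmxA; apply: le_trans (Py i).
  exact: stochastic_le.
apply: le_trans (ler_sum _ (fun k _ => Pk k)) _.
by rewrite sumr_const_nat subn0.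
Qed.

Lemma null_column_mulmx m (A B : 'M[R]_(n, m)) s :
  (forall u, Q u s = 0) -> (forall t, t != s -> row t A = row t B) ->
  Q *m A = Q *m B.
Proof.
move=> Qs AB; apply/matrixP => u k; rewrite !mxE; apply: eq_bigr => t _.
have [->|ts] := eqVneq t s; first by rewrite Qs !mul0r.
by have /rowP/(_ k) := AB t ts; rewrite !mxE => ->.
Qed.

End ErgodicFacts.

Lemma nonsingular_ker (R : realType) m n (A : 'M[R]_(m, n)) (x : 'cV[R]_n) :
  nonsingular A -> A *m x = 0 -> x = 0.
Proof.
case=> e; case: n / e A x => A x; rewrite castmx_id => Au Ax.
by rewrite -[x](mulKmx Au) Ax mulmx0.
Qed.

Section Uniqueness.
Variables (R : realType) (K : nat) (G : stochastic_game R K).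
Implicit Types (f : strategy G P1) (g : strategy G P2) (v h : 'cV[R]_K).
Hypothesis controlled : player2_controlled G.

(** Against [f], all the actions of player 2 satisfy the average-reward
    optimality equations, with gain [v] and bias [h]. *)
Definition equalizing f v h := forall s (j : 'I_(actions G P2 s)),
  v s 0 = continuation j v /\
  v s 0 + h s 0 = reward_col f j + continuation j h.

Lemma average_const k (a : strategy G k) s c :
  stationary a -> \sum_i a s 0 i * c = c.
Proof. by move=> ast; rewrite -mulr_suml (ast s).2 mul1r. Qed.

Lemma equalizing_payoff f g v h : stationary f -> stationary g ->
  equalizing f v h -> forall s, undiscounted_payoff P2 f g s = v s 0.
Proof.
move=> fst gst eqz s.
have [Q [X erg]] := ergodic_projection (law_stochastic gst).
have [_ _ QP _] := erg.
rewrite (undiscounted_payoffE controlled _ _ fst gst erg).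
have Pv : law g *m v = v.
  apply/colP => t; rewrite lawM; under eq_bigr do rewrite -(eqz t _).1.
  exact: average_const.
have -> : rewards P2 f g = v + (h - law g *m h).
  apply/colP => t; rewrite !(addmxE, oppmxE) lawM rewards2E.
  rewrite addrA; apply/eqP; rewrite eq_sym subr_eq; apply/eqP.
  rewrite -big_split /=; under [RHS]eq_bigr do rewrite -mulrDr -(eqz t _).2.
  by rewrite average_const.
rewrite mulmxDr mulmxBr mulmxA QP subrr addr0.
by rewrite (ergodic_fixed (law_stochastic gst) erg Pv).
Qed.

Section Deviation.
Variables (f : strategy G P1) (g : strategy G P2) (s : 'I_K) (j : 'I_(actions G P2 s)).
Hypotheses (fst : stationary f) (gst : stationary g).
Hypothesis f_opt : forall f', stationary f' -> forall t,
  undiscounted_payoff P1 f' g t <= undiscounted_payoff P1 f g t.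

Definition switch : strategy G P2 :=
  dfwith g s (delta_mx 0 j : 'rV[R]_(actions G P2 s)).

Lemma switch_stationary : stationary switch.
Proof. by apply: update_stationary => //; exact: pure_distribution. Qed.

Lemma switch_out t : t != s -> switch t = g t.
Proof. by move=> ts; rewrite /switch dfwithout // eq_sym. Qed.

Lemma law_switch_out t v : t != s -> (law switch *m v) t 0 = (law g *m v) t 0.
Proof. by move=> ts; rewrite !lawM switch_out. Qed.

Lemma law_switch_in v : (law switch *m v) s 0 = continuation j v.
Proof. by rewrite lawM /switch dfwithin sum_pure. Qed.

Lemma rewards_switch_out t : t != s -> rewards P2 f switch t 0 = rewards P2 f g t 0.
Proof. by move=> ts; rewrite !rewards2E switch_out. Qed.

Lemma rewards_switch_in : rewards P2 f switch s 0 = reward_col f j.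
Proof. by rewrite rewards2E /switch dfwithin sum_pure. Qed.

Lemma row_col (A : 'cV[R]_K) (B : 'cV[R]_K) t : A t 0 = B t 0 -> row t A = row t B.
Proof. by move=> AB; apply/rowP => k; rewrite !mxE !ord1. Qed.

Section NullColumn.
Variables (Q X Q' X' : 'M[R]_K).
Hypotheses (erg : ergodic (law g) Q X) (erg' : ergodic (law switch) Q' X').
Hypothesis null_s : forall u, Q' u s = 0.

Lemma null_switch_invariant : Q' *m law g = Q'.
Proof.
have [_ _ Q'P' _] := erg'; rewrite -[RHS]Q'P'.
apply: (null_column_mulmx null_s) => t ts; apply/rowP => k.
by rewrite !mxE switch_out.
Qed.

(** The long-run distributions under [switch] avoid [s], hence are
    stationary for [law g], and are carried by its recurrent states. *)
Lemma null_switch_best_reply u t : 0 < Q' u t -> plays_best_reply f switch t.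
Proof.
move=> Qut; have ts : t != s by apply: contraTneq Qut => ->; rewrite null_s ltxx.
have [w Qwt] : exists w, 0 < Q w t.
  have [[Q0 _] _ _ _] := erg; have [[Q'0 _] _ _ _] := erg'.
  apply: contrapT => nex; move: Qut.
  rewrite -(ergodic_invariant erg null_switch_invariant) mxE big1 ?ltxx // => w _.
  suff -> : Q w t = 0 by rewrite mulr0.
  by apply/eqP; rewrite eq_le Q0 andbT leNgt; apply/negP => Qwt; apply: nex; exists w.
rewrite /plays_best_reply switch_out //.
exact: (optimal1P controlled fst gst erg).1 f_opt w t Qwt.
Qed.

End NullColumn.
End Deviation.

Hypothesis mixed : completely_mixed_game G.

Lemma switch_nash_single f g s (j : 'I_(actions G P2 s)) :
  nash_equilibrium f (switch g j) -> forall j', j' = j.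
Proof.
move=> /mixed [_ /(_ s)]; rewrite /switch dfwithin => pos j'.
by apply/eqP; apply: contraT => jj; have := pos j'; rewrite mxE (negPf jj) ltxx.
Qed.

(** Were some continuation of [v] larger than [v], switching there would
    improve the gain. *)
Lemma gain_harmonic f g Q X : nash_equilibrium f g -> ergodic (law g) Q X ->
  forall s (j : 'I_(actions G P2 s)),
  let v := Q *m rewards P2 f g in v s 0 = continuation j v.
Proof.
move=> ne erg s j v; have [_ gmix] := mixed ne; case: ne => fst gst opt1 opt2.
have [_ PQ _ eqX] := erg; pose r := rewards P2 f g; pose h := X *m r.
suff le_v (j' : 'I_(actions G P2 s)) : continuation j' v <= v s 0.
  apply/esym; apply: (average_max (gst s) le_v _ (gmix s j)).
  by rewrite -lawM /v mulmxA PQ.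
rewrite leNgt; apply/negP => gain.
have g'st : stationary (switch g j') by exact: switch_stationary.
have [Q' [X' erg']] := ergodic_projection (law_stochastic g'st).
have [[Q'0 _] P'Q' Q'P' _] := erg'.
pose d := law (switch g j') *m v - v.
have d_out t : t != s -> d t 0 = 0.
  by move=> ts; rewrite addmxE oppmxE law_switch_out // /v mulmxA PQ subrr.
have d_in : 0 < d s 0 by rewrite addmxE oppmxE law_switch_in subr_gt0.
have null u : Q' u s = 0.
  have : (Q' *m d) u 0 = 0 by rewrite mulmxBr (mulmxA Q' (law _)) Q'P' subrr mxE.
  rewrite mxE (bigD1 s) //= big1 ?addr0 => [|t ts]; last by rewrite d_out ?mulr0.
  by move/eqP; rewrite mulf_eq0 (gt_eqF d_in) orbF => /eqP.
have Q'r : Q' *m rewards P2 f (switch g j') = Q' *m v.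
  rewrite (@null_column_mulmx _ _ _ _ _ (v + (h - law (switch g j') *m h)) s) //.
    by rewrite mulmxDr mulmxBr (mulmxA Q' (law _)) Q'P' subrr addr0.
  move=> t ts; apply: row_col; rewrite rewards_switch_out // !(addmxE, oppmxE).
  rewrite law_switch_out // -/r -!(addmxE, oppmxE).
  by rewrite -[h in h - _]mul1mx -mulmxBl mulmxA -eqX mulmxBl mul1mx addrC subrK.
pose y := Q' *m v - v.
have Py : law (switch g j') *m y = y - d.
  by rewrite mulmxBr mulmxA P'Q' /y /d opprB addrA subrK.
have y0 t : 0 <= y t 0.
  have -> : 0 = (Q' *m y) t 0.
    by rewrite mulmxBr mulmxA (ergodic_invariant erg' Q'P') subrr mxE.
  apply: (ergodic_superharmonic (law_stochastic g'st) erg') => u.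
  rewrite Py addmxE oppmxE gerBl.
  by have [->|us] := eqVneq u s; [exact: ltW | rewrite d_out].
have := opt2 _ g'st s.
rewrite (undiscounted_payoffE controlled _ _ fst g'st erg') Q'r.
rewrite (undiscounted_payoffE controlled _ _ fst gst erg) -/v.
have : 0 <= (law (switch g j') *m y) s 0.
  rewrite mxE; apply: sumr_ge0 => t _; apply: mulr_ge0 => //.
  by case: (law_stochastic g'st).
by rewrite Py !addmxE !oppmxE; lra.
Qed.

(** An action [j] improving the bias equation at [s] cannot improve the gain, so
    [s] is transient once player 2 switches to it; then the switch is again an
    equilibrium, which is completely mixed only if [j] is the only action. *)
Theorem nash_equalizing f g : nash_equilibrium f g ->
  exists v h, equalizing f v h.
Proof.
move=> ne; have [_ gmix] := mixed ne; have [fst gst opt1 opt2] := ne.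
have [Q [X erg]] := ergodic_projection (law_stochastic gst).
pose r := rewards P2 f g; pose v := Q *m r; pose h := X *m r.
have v_harm s (j : 'I_(actions G P2 s)) : v s 0 = continuation j v.
  exact: (gain_harmonic ne erg).
have bias s : v s 0 + h s 0 = \sum_j g s 0 j * (reward_col f j + continuation j h).
  under eq_bigr do rewrite mulrDr.
  rewrite big_split /= -rewards2E -lawM -!addmxE; congr (fun_of_matrix _ s 0).
  have [_ _ _ eqX] := erg.
  have E : r - v = h - law g *m h.
    by rewrite /v -[r in r - _]mul1mx -mulmxBl eqX -mulmxA mulmxBl mul1mx.
  by apply/eqP; rewrite -subr_eq -addrA -E addrCA subrr addr0.
exists v, h => s j; split; first exact: v_harm.
suff le_h (j' : 'I_(actions G P2 s)) :
    reward_col f j' + continuation j' h <= v s 0 + h s 0.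
  apply/esym; apply: (average_max (gst s) le_h _ (gmix s j)).
  by rewrite bias.
rewrite leNgt; apply/negP => gain.
have g'st : stationary (switch g j') by exact: switch_stationary.
have [Q' [X' erg']] := ergodic_projection (law_stochastic g'st).
have [[Q'0 _] _ Q'P' _] := erg'.
pose r' := rewards P2 f (switch g j').
pose e := r' + law (switch g j') *m h - v - h.
have e_out t : t != s -> e t 0 = 0.
  move=> ts; rewrite !(addmxE, oppmxE) rewards_switch_out // law_switch_out //.
  have := bias t; under eq_bigr do rewrite mulrDr.
  by rewrite big_split /= -rewards2E -lawM => <-; ring.
have e_in : 0 < e s 0.
  by rewrite !(addmxE, oppmxE) rewards_switch_in law_switch_in -addrA -opprD subr_gt0.
have Q'v : Q' *m v = v.
  apply: (ergodic_fixed (law_stochastic g'st) erg'); apply/colP => t.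
  rewrite lawM; under eq_bigr do rewrite -v_harm.
  exact: average_const.
have Q'r : Q' *m r' = v + Q' *m e.
  rewrite /e !mulmxBr mulmxDr Q'v (mulmxA Q' (law _)) Q'P'.
  by rewrite addrAC addrK [RHS]addrC subrK.
have Q'e u : (Q' *m e) u 0 = Q' u s * e s 0.
  rewrite mxE (bigD1 s) //= big1 ?addr0 // => t ts.
  by rewrite e_out ?mulr0.
have null u : Q' u s = 0.
  apply/eqP; rewrite eq_le Q'0 andbT -(pmulr_lle0 _ e_in) -Q'e.
  have := opt2 _ g'st u.
  rewrite (undiscounted_payoffE controlled _ _ fst g'st erg') Q'r.
  by rewrite (undiscounted_payoffE controlled _ _ fst gst erg) -/v addmxE gerDl.
have ne' : nash_equilibrium f (switch g j').
  split=> //.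
    apply/(optimal1P controlled fst g'st erg') => u t.
    exact: (null_switch_best_reply fst gst opt1 erg erg' null).
  move=> g'' g''st u; apply: le_trans (opt2 _ g''st u) _.
  rewrite (undiscounted_payoffE controlled _ _ fst g'st erg') Q'r.
  rewrite (undiscounted_payoffE controlled _ _ fst gst erg) -/v addmxE Q'e.
  by rewrite null mul0r addr0.
have single := switch_nash_single ne'.
move: gain; rewrite bias.
rewrite (@average_eq _ _ _ _ (reward_col f j' + continuation j' h) (gst s)) ?ltxx //.
by move=> i _; rewrite (single i).
Qed.

(** If the state [t] were recurrent for every switch at [t], the mixture of the
    corresponding invariant measures, scaled to the mass 1 at [t], would be an
    invariant measure of [law g] charging [t]. *)
Theorem null_state_single f g Q X t : nash_equilibrium f g ->
  ergodic (law g) Q X -> (forall u, Q u t = 0) ->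
  forall j j' : 'I_(actions G P2 t), j = j'.
Proof.
move=> ne erg null_t j0 j1; have [fst gst opt1 opt2] := ne.
have sw_st (j : 'I_(actions G P2 t)) : stationary (switch g j).
  exact: switch_stationary.
have [Q_ Q_P] := choice (fun j : 'I_(actions G P2 t) =>
  ergodic_projection (law_stochastic (sw_st j))).
have [X_ X_P] := choice Q_P.
have [[j null_j]|nnull] := pselect (exists j, forall u, Q_ j u t = 0).
  have [v [h eqz]] := nash_equalizing ne.
  have ne' : nash_equilibrium f (switch g j).
    split=> // [|g' g'st s].
      apply/(optimal1P controlled fst (sw_st j) (X_P j)) => u s.
      exact: (null_switch_best_reply fst gst opt1 erg (X_P j) null_j).
    by rewrite !(equalizing_payoff _ _ eqz).
  by rewrite (switch_nash_single ne' j0) (switch_nash_single ne' j1).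
have mu_ex (j : 'I_(actions G P2 t)) : exists mu : 'rV[R]_K,
    mu *m law (switch g j) = mu /\ mu 0 t = 1.
  have [u Qu] : exists u, Q_ j u t != 0.
    apply: contrapT => nex; apply: nnull; exists j => u; apply/eqP.
    by apply: contrapT => /negP Qu; apply: nex; exists u.
  have [_ _ QP _] := X_P j.
  exists ((Q_ j u t)^-1 *: row u (Q_ j)); split.
    by rewrite -scalemxAl -row_mul QP.
  by rewrite !mxE mulVf.
have [mu mu_P] := choice mu_ex.
pose nu := \sum_j g t 0 j *: mu j.
have nu_t : nu 0 t = 1.
  rewrite summxE -(gst t).2; apply: eq_bigr => j _.
  by rewrite mxE (mu_P j).2 mulr1.
have muE j : mu j *m law g = mu j + (row t (law g) - row t (law (switch g j))).
  rewrite -{2}(mu_P j).1 -[law g in LHS](subrK (law (switch g j))) mulmxDr addrC.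
  congr (_ + _); rewrite mulmx_sum_row (bigD1 t) //= big1 => [|u ut].
    by rewrite (mu_P j).2 scale1r addr0 linearB.
  by apply/rowP => k; rewrite !mxE switch_out // subrr mulr0.
have nuP : nu *m law g = nu.
  rewrite mulmx_suml; under eq_bigr do rewrite -scalemxAl muE scalerDr.
  rewrite big_split /= -/nu [X in _ + X](_ : _ = 0) ?addr0 //.
  apply/rowP => k; rewrite summxE [RHS]mxE.
  transitivity (\sum_j (g t 0 j * law g t k -
      g t 0 j * transition G t (action1 G t) j k)).
    apply: eq_bigr => j _; rewrite -mulrBr !mxE; congr (_ * (_ - _)).
    by rewrite /switch dfwithin sum_pure.
  by rewrite sumrB average_const // [law g t k]mxE subrr.
have /eqP := nu_t; rewrite -(ergodic_invariant erg nuP) mxE big1 => [|u _].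
  by rewrite eq_sym oner_eq0.
by rewrite null_t mulr0.
Qed.

Lemma recurrent_equalized f g Q X s t : nash_equilibrium f g ->
  ergodic (law g) Q X -> Q s t != 0 ->
  forall i i' : 'I_(actions G P1 t), reward_row g i = reward_row g i'.
Proof.
move=> ne erg Qst i i'; have [fmix _] := mixed ne; case: ne => fst gst opt1 _.
have [[Q0 _] _ _ _] := erg.
have Qpos : 0 < Q s t by rewrite lt_def Qst Q0.
have /plays_best_replyP br := (optimal1P controlled fst gst erg).1 opt1 s t Qpos.
by apply/eqP; rewrite eq_le !br.
Qed.

Hypothesis R1_nonsingular : forall s, nonsingular (reward G P1 s).

(** At a recurrent state [s], [R^1(s) g(s)] is a constant vector; as [R^1(s)] is
    nonsingular, this determines [g s] up to a factor, and [g s] has mass 1. *)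
Lemma nash_unique2 f g f' g' : nash_equilibrium f g -> nash_equilibrium f' g' ->
  g = g'.
Proof.
move=> ne ne'; have [_ gst _ _] := ne; have [_ g'st _ _] := ne'.
have [Q [X erg]] := ergodic_projection (law_stochastic gst).
have [Q' [X' erg']] := ergodic_projection (law_stochastic g'st).
apply: functional_extensionality_dep => s.
have single (all_eq : forall j j' : 'I_(actions G P2 s), j = j') : g s = g' s.
  apply/rowP => j.
  have one (a : strategy G P2) : stationary a -> a s 0 j = 1.
    move=> ast; rewrite -(ast s).2 (bigD1 j) //= big1 ?addr0 // => j'.
    by rewrite (all_eq j' j) eqxx.
  by rewrite !one.
have [null|/existsNP[u /eqP Qu]] := pselect (forall u, Q u s = 0).
  exact/single/(null_state_single ne erg null).
have [null|/existsNP[u' /eqP Qu']] := pselect (forall u, Q' u s = 0).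
  exact/single/(null_state_single ne' erg' null).
pose i0 := action1 G s; pose c := reward_row g i0; pose c' := reward_row g' i0.
have colE (a : strategy G P2) (d : R) :
    (forall i : 'I_(actions G P1 s), reward_row a i = d) ->
    reward G P1 s *m (a s)^T = const_mx d.
  move=> ad; apply/colP => i; rewrite !mxE -(ad i).
  by apply: eq_bigr => j _; rewrite mxE.
have gE : reward G P1 s *m (g s)^T = const_mx c.
  by apply: colE => i; exact: (recurrent_equalized ne erg Qu).
have g'E : reward G P1 s *m (g' s)^T = const_mx c'.
  by apply: colE => i; exact: (recurrent_equalized ne' erg' Qu').
have prop : c' *: g s = c *: g' s.
  apply/eqP; rewrite -subr_eq0; apply/eqP/trmx_inj; rewrite trmx0.
  apply: (nonsingular_ker (R1_nonsingular s)).
  have -> : (c' *: g s - c *: g' s)^T = c' *: (g s)^T - c *: (g' s)^T.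
    by rewrite linearB !linearZ.
  rewrite mulmxBr -!scalemxAr gE g'E.
  by apply/colP => i; rewrite !mxE mulrC subrr.
have cc' : c' = c.
  rewrite -[LHS]mulr1 -[RHS]mulr1 -{1}(gst s).2 -(g'st s).2 !mulr_sumr.
  by apply: eq_bigr => j _; have /rowP/(_ j) := prop; rewrite !mxE.
have c0 : c != 0.
  apply/eqP => c0; have gs0 : (g s)^T = 0.
    apply: (nonsingular_ker (R1_nonsingular s)).
    by rewrite gE c0; apply/colP => i; rewrite !mxE.
  have /eqP := (gst s).2; rewrite big1 1?eq_sym ?oner_eq0 // => j _.
  by have /colP/(_ j) := gs0; rewrite !mxE.
by move: prop; rewrite cc' => /(scalerI c0).
Qed.

(** The strategies of player 1 that equalize player 2 form an affine space; a
    line through two of them leaves the completely mixed strategies at a point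
    that is still an equilibrium. *)
Lemma nash_unique1 f f' g : nash_equilibrium f g -> nash_equilibrium f' g -> f = f'.
Proof.
move=> ne ne'; have [fst gst opt1 opt2] := ne; have [f'st _ _ _] := ne'.
apply: contrapT => ff'; have [fmix _] := mixed ne.
have [v [h eqz]] := nash_equalizing ne; have [v' [h' eqz']] := nash_equalizing ne'.
pose E : finType := {s : 'I_K & 'I_(actions G P1 s)}.
pose d (e : E) := f' (tag e) 0 (tagged e) - f (tag e) 0 (tagged e).
have [|e1 d_e1 min_e1] := @ratio_test R E d (fun e => f (tag e) 0 (tagged e)).
  apply: contrapT => nex; apply: ff'; apply: functional_extensionality_dep => s.
  have d0 i : 0 <= f' s 0 i - f s 0 i.
    by rewrite leNgt; apply/negP => di; apply: nex; exists (existT _ s i).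
  have /eqP : \sum_i (f' s 0 i - f s 0 i) = 0 by rewrite sumrB (fst s).2 (f'st s).2 subrr.
  rewrite psumr_eq0 // => /allP d_eq0; apply/rowP => i.
  by apply/esym/eqP; rewrite -subr_eq0; exact: d_eq0 (mem_index_enum i).
set lam := (_ / _) in min_e1.
pose F : strategy G P1 := fun s => f s + lam *: (f' s - f s).
have FE s i : F s 0 i = f s 0 i + lam * (f' s 0 i - f s 0 i) by rewrite !mxE.
have lam0 : 0 < lam by rewrite divr_gt0 ?oppr_gt0 //; exact: fmix.
have Fst : stationary F.
  move=> s; split=> [i|].
    rewrite FE; have [di|di] := ltP (f' s 0 i - f s 0 i) 0; last first.
      by rewrite addr_ge0 ?(ltW (fmix _ _)) // mulr_ge0 // ltW.
    have := min_e1 (existT _ s i) di; rewrite ler_pdivlMr ?oppr_gt0 // /d /=.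
    lra.
  under eq_bigr do rewrite FE.
  by rewrite big_split /= -mulr_sumr sumrB (fst s).2 (f'st s).2 subrr mulr0 addr0.
have eqzF : equalizing F (v + lam *: (v' - v)) (h + lam *: (h' - h)).
  move=> s j; have [v1 h1] := eqz s j; have [v2 h2] := eqz' s j.
  have contD (a b : 'cV[R]_K) : continuation j (a + lam *: (b - a)) =
      continuation j a + lam * (continuation j b - continuation j a).
    rewrite -sumrB mulr_sumr -big_split /=; apply: eq_bigr => u _.
    by rewrite !(addmxE, scalemxE, oppmxE); ring.
  have colD : reward_col F j = reward_col f j + lam * (reward_col f' j - reward_col f j).
    rewrite -sumrB mulr_sumr -big_split /=; apply: eq_bigr => i _.
    by rewrite FE; ring.
  rewrite !(addmxE, scalemxE, oppmxE) !contD colD -v1 -v2; split=> //.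
  have -> : h s 0 = reward_col f j + continuation j h - v s 0 by rewrite -h1; ring.
  have -> : h' s 0 = reward_col f' j + continuation j h' - v' s 0 by rewrite -h2; ring.
  by ring.
have neF : nash_equilibrium F g.
  split=> // [|g' g'st s]; last by rewrite !(equalizing_payoff _ _ eqzF).
  have [Q [X erg]] := ergodic_projection (law_stochastic gst).
  apply/(optimal1P controlled Fst gst erg) => s t Qst.
  apply/plays_best_replyP => i i' _.
  by rewrite (recurrent_equalized ne erg (lt0r_neq0 Qst) i i').
have [/(_ (tag e1) (tagged e1))] := mixed neF.
rewrite FE -/(d e1) /lam invrN mulrN mulNr divfK ?subrr ?ltxx //.
exact: ltr0_neq0.
Qed.

End Uniqueness.

Theorem theorem4p11 (R : realType) (K : nat) (G : stochastic_game R K)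
  (G_controlled : player2_controlled G)
  (G_mixed : completely_mixed_game G)
  (R1_nonsingular : forall s : 'I_K, nonsingular (reward G P1 s)) :
  exists! fg : strategy G P1 * strategy G P2, nash_equilibrium fg.1 fg.2.
Proof.
have [f [g ne]] := equilibrium_exists G_controlled.
exists (f, g); split=> // -[f' g'] /= ne'.
have gg' := nash_unique2 G_controlled G_mixed R1_nonsingular ne ne'.
rewrite -{}gg' in ne' *.
by rewrite (nash_unique1 G_controlled G_mixed ne ne').
Qed.
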